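(* Let $r\in\mathbf{N}\cup\{\infty\}$, let $M$ be any closed $C^r$-manifold, let $n\geq 1$, and let $Z$ be $C^r$-diffeomorphic to $M\times \mathbf{R}^n$. Then the groups $\mathrm{Homeo}_c(Z)$, $\mathrm{Homeo}_{c, \circ}(Z)$, $\mathrm{Diff}^r_c(Z)$ and $\mathrm{Diff}^r_{c, \circ}(Z)$ are boundedly acyclic.
   Context: All groups are considered as abstract (discrete) groups. $\mathrm{Homeo}_c(Z)$ and $\mathrm{Diff}^r_c(Z)$ are the groups of compactly supported homeomorphisms, respectively $C^r$-diffeomorphisms, of $Z$; $\mathrm{Homeo}_{c,\circ}(Z)$ and $\mathrm{Diff}^r_{c,\circ}(Z)$ are their neutral components, i.e. the subgroups of elements isotopic to the identity through compactly supported homeomorphisms (respectively $C^r$-diffeomorphisms). For an abstract group $G$, the bounded cohomology $H^\bullet_b(G)$ (trivial real coefficients) is the cohomology of the complex $0\to \ell^\infty(G)^G\to \ell^\infty(G^2)^G\to \ell^\infty(G^3)^G\to\cdots$ of bounded real functions invariant under the diagonal $G$-action, with the usual homogeneous differentials. $G$ is called boundedly acyclic if $H^n_b(G)=0$ for all $n>0$. *)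

(* Defs.v *)
From HB Require Import structures.
From mathcomp Require Import all_boot all_order all_algebra.
From mathcomp Require Import lra.
From mathcomp Require Import all_classical all_reals all_analysis.

Set Implicit Arguments.
Unset Strict Implicit.
Unset Printing Implicit Defensive.

Import Order.TTheory GRing.Theory Num.Theory.
Import numFieldNormedType.Exports.
Local Open Scope classical_set_scope.
Local Open Scope ring_scope.

Section BoundedCohomology.
Variables (R : realType) (G : groupType).

(* [bounded_cochain n] is $\ell^\infty(G^{n+1})^G$. *)
Definition bounded_cochain (n : nat) : set (('I_n.+1 -> G) -> R) :=
  [set f | (exists C : R, forall g, `|f g| <= C) /\
           (forall (x : G) g, f (fun i => (x * g i)%g) = f g)].

Definition codiff (n : nat) (f : ('I_n.+1 -> G) -> R) (g : 'I_n.+2 -> G) : R :=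
  \sum_(i < n.+2) (-1) ^+ i * f (fun j => g (lift i j)).

Definition bounded_cocycle (n : nat) : set (('I_n.+1 -> G) -> R) :=
  [set f | bounded_cochain f /\ forall g, codiff f g = 0].

Definition bounded_coboundary (n : nat) : set (('I_n.+2 -> G) -> R) :=
  [set f | exists2 b : ('I_n.+1 -> G) -> R,
     bounded_cochain b & f = codiff b].

(* $H^{n+1}_b(G) = 0$ for all [n]. *)
Definition boundedly_acyclic : Prop :=
  forall n : nat, @bounded_cocycle n.+1 `<=` @bounded_coboundary n.

End BoundedCohomology.

Record selfbij (T : Type) := SelfBij {
  selfbij_fun :> T -> T;
  selfbij_inv : T -> T;
  selfbijK : cancel selfbij_fun selfbij_inv;
  selfbijVK : cancel selfbij_inv selfbij_fun }.

HB.instance Definition _ T := gen_eqMixin (selfbij T).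
HB.instance Definition _ T := gen_choiceMixin (selfbij T).

Section SelfBijGroup.
Variable T : Type.

Lemma selfbij_eq (f g : selfbij T) : f =1 g -> f = g.
Proof.
case: f g => [f f' fK fK'] [g g' gK gK'] /= /funext efg.
move: efg fK fK' => -> fK fK'.
have e : f' = g' by apply/funext => x; rewrite -{1}(gK' x) fK.
by move: e fK fK' => -> fK fK'; congr SelfBij; exact: Prop_irrelevance.
Qed.

Definition selfbij1 : selfbij T :=
  @SelfBij T id id (fun=> erefl) (fun=> erefl).

Definition selfbijM (f g : selfbij T) : selfbij T :=
  SelfBij (can_comp (selfbijK f) (selfbijK g))
          (can_comp (selfbijVK g) (selfbijVK f)).

Definition selfbijV (f : selfbij T) : selfbij T :=
  SelfBij (selfbijVK f) (selfbijK f).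

Lemma selfbijMA : associative selfbijM.
Proof. by move=> f g h; exact: selfbij_eq. Qed.

Lemma selfbij1M : left_id selfbij1 selfbijM.
Proof. by move=> f; exact: selfbij_eq. Qed.

Lemma selfbijM1 : right_id selfbij1 selfbijM.
Proof. by move=> f; exact: selfbij_eq. Qed.

Lemma selfbijVM : left_inverse selfbij1 selfbijV selfbijM.
Proof. by move=> f; apply: selfbij_eq => x /=; exact: selfbijK. Qed.

Lemma selfbijMV : right_inverse selfbij1 selfbijV selfbijM.
Proof. by move=> f; apply: selfbij_eq => x /=; exact: selfbijVK. Qed.

HB.instance Definition _ := isGroup.Build (selfbij T)
  selfbijMA selfbij1M selfbijM1 selfbijVM selfbijMV.

End SelfBijGroup.

Record subgroup (G : groupType) := Subgroup {
  subgroup_set : set G;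
  subgroup1 : subgroup_set 1%g;
  subgroupM : forall x y,
    subgroup_set x -> subgroup_set y -> subgroup_set (x * y)%g;
  subgroupV : forall x, subgroup_set x -> subgroup_set (x^-1)%g }.

Section SubgroupGroup.
Variables (G : groupType) (H : subgroup G).

Definition subgroup_type := {x : G | x \in subgroup_set H}.

HB.instance Definition _ := SubChoice.on subgroup_type.

Lemma subgroup_closed : group_closed (mem (subgroup_set H)).
Proof.
split=> [|x y]; rewrite ?inE; first exact: subgroup1.
by move=> Hx Hy; apply: subgroupM => //; exact: subgroupV.
Qed.

HB.instance Definition _ :=
  SubChoice_isSubGroup.Build G (mem (subgroup_set H)) subgroup_type
    subgroup_closed.

Definition subgroup_group : groupType := subgroup_type.

End SubgroupGroup.
Coercion subgroup_group : subgroup >-> groupType.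

Section ClassCk.
Variable R : realType.

Section Def.
Variables (m : nat) (W : normedModType R).

(* Only used for [U] open. In finite dimension, [fun x => 'd f x] is of class
   $C^k$ if and only if all the [fun x => 'd f x v] are. *)
Fixpoint Ck (k : nat) (U : set 'rV[R]_m) (f : 'rV[R]_m -> W) : Prop :=
  if k is k'.+1 then
    (forall x, U x -> differentiable f x) /\
    (forall v, Ck k' U (fun x => 'd f x v))
  else forall x, U x -> {for x, continuous f}.

(* [r] ranges over $\mathbf{N} \cup \{\infty\}$, with [None] for $\infty$. *)
Definition Cr (r : option nat) (U : set 'rV[R]_m) (f : 'rV[R]_m -> W) : Prop :=
  forall k : nat, (if r is Some s then k <= s else true)%N -> Ck k U f.

End Def.

Lemma near_eq_diff (V W : normedModType R) (f g : V -> W) (x : V) :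
  (\near x, f x = g x) -> differentiable f x ->
  differentiable g x /\ 'd g x = 'd f x :> (V -> W).
Proof.
move=> efg df; have [dfc dfE] := (diff_locallyP _ _).1 df.
have gE : g \o shift x = cst (g x) + 'd f x +o_ 0 id.
  apply/eqaddoP => e e0; have /eqaddoP/(_ e e0) := dfE.
  have efg0 : \forall h \near (0 : V), f (h + x) = g (h + x).
    by move: efg; rewrite (near_shift 0); apply: filterS => h /=; rewrite subr0.
  have efgx : f x = g x by exact: nbhs_singleton efg.
  by apply: filterS2 efg0 => h /= e1; rewrite !fctE /= -e1 -efgx.
have dgE := diff_unique dfc gE.
by split=> //; apply/diff_locallyP; rewrite dgE; split.
Qed.

Lemma Ck_cont m (W : normedModType R) k (U : set 'rV[R]_m) (f : 'rV[R]_m -> W) :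
  Ck k U f -> forall x, U x -> {for x, continuous f}.
Proof.
case: k => // k [df _] x Ux; exact: differentiable_continuous (df x Ux).
Qed.

Lemma Ck_sub m (W : normedModType R) k (U U' : set 'rV[R]_m)
    (f : 'rV[R]_m -> W) : U' `<=` U -> Ck k U f -> Ck k U' f.
Proof.
move=> sU; elim: k f => [|k ih] f /=; first by move=> cf x /sU; exact: cf.
by move=> [df Df]; split => [x /sU|v]; [exact: df | exact: ih].
Qed.

Lemma Ck_local m (W : normedModType R) k (U : set 'rV[R]_m)
    (f : 'rV[R]_m -> W) :
  (forall x, U x -> exists2 V, V x & Ck k V f) -> Ck k U f.
Proof.
elim: k f => [|k ih] f /= H.
  by move=> x /H [V Vx]; exact.
split=> [x /H [V Vx [+ _]]|v]; first exact.
by apply: ih => x /H [V Vx [_ /(_ v)]]; exists V.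
Qed.

Lemma Ck_ext m (W : normedModType R) k (U : set 'rV[R]_m)
    (f g : 'rV[R]_m -> W) :
  open U -> (forall x, U x -> f x = g x) -> Ck k U f -> Ck k U g.
Proof.
move=> oU; elim: k f g => [|k ih] f g efg /=.
  move=> cf x Ux; rewrite /prop_for /continuous_at -efg//.
  apply: cvg_trans (cf x Ux); have nfg : {near x, f =1 g}.
    by apply: filterS (open_nbhs_nbhs (conj oU Ux)) => y; exact: efg.
  exact: near_eq_cvg nfg.
move=> [df Df].
have nfg x : U x -> \near x, f x = g x.
  by move=> Ux; apply: filterS (open_nbhs_nbhs (conj oU Ux)) => y; exact: efg.
split=> [x Ux|v]; first by have [] := near_eq_diff (nfg x Ux) (df x Ux).
apply: ih (Df v) => x Ux.
by have [_ ->] := near_eq_diff (nfg x Ux) (df x Ux).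
Qed.

Lemma Ck_cst m (W : normedModType R) k (U : set 'rV[R]_m) (c : W) :
  Ck k U (fun=> c).
Proof.
elim: k c => [|k ih] c /=; first by move=> x _; exact: (@cst_continuous _ _ c x).
split=> [x _|v]; first exact: differentiable_cst.
suff -> : (fun x => 'd (fun=> c) x v) = (fun=> 0) :> ('rV[R]_m -> W) by exact: ih.
by apply/funext => x; rewrite (_ : (fun=> c) = cst c)// diff_cst.
Qed.

Lemma Ck_lin m (V W : normedModType R) k (U : set 'rV[R]_m)
    (L : {linear V -> W}) (f : 'rV[R]_m -> V) :
  open U -> continuous L -> Ck k U f -> Ck k U (L \o f).
Proof.
move=> oU cL; elim: k f => [|k ih] f /=.
  by move=> cf x Ux; apply: continuous_comp; [exact: cf | exact: cL].
move=> [df Df]; split=> [x Ux|v].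
  by apply: differentiable_comp; [exact: df | exact: linear_differentiable].
apply: (@Ck_ext _ _ _ _ (L \o (fun x => 'd f x v))) => //; last exact: ih.
move=> x Ux; rewrite diff_comp//; last 2 first.
- exact: df.
- exact: linear_differentiable.
by rewrite /= diff_lin.
Qed.

Lemma Ck_id m k (U : set 'rV[R]_m) : Ck k U id.
Proof.
case: k => [|k] /=; first by move=> x _ A.
split=> [x _|v]; first exact: ex_diff.
suff -> : (fun x => 'd id x v) = (fun=> v) :> ('rV[R]_m -> 'rV[R]_m).
  exact: Ck_cst.
by apply/funext => x; rewrite diff_val.
Qed.

Lemma Ck_linear m (W : normedModType R) k (U : set 'rV[R]_m)
    (L : {linear 'rV[R]_m -> W}) : open U -> continuous L -> Ck k U L.
Proof. by move=> oU cL; exact: (Ck_lin oU cL (Ck_id _ _)). Qed.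

Lemma Ck_add m (W : normedModType R) k (U : set 'rV[R]_m)
    (f g : 'rV[R]_m -> W) :
  open U -> Ck k U f -> Ck k U g -> Ck k U (fun x => f x + g x).
Proof.
move=> oU; elim: k f g => [|k ih] f g /=.
  by move=> cf cg x Ux; apply: continuousD; [exact: cf | exact: cg].
move=> [df Df] [dg Dg]; split=> [x Ux|v].
  by apply: differentiableD; [exact: df | exact: dg].
apply: (@Ck_ext _ _ _ _ (fun x => 'd f x v + 'd g x v)) => //; last exact: ih.
by move=> x Ux; rewrite diffD; [|exact: df|exact: dg].
Qed.

Lemma Ck_sum m (W : normedModType R) k (U : set 'rV[R]_m) n
    (f : 'I_n -> 'rV[R]_m -> W) :
  open U -> (forall i, Ck k U (f i)) -> Ck k U (fun x => \sum_i f i x).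
Proof.
move=> oU Hf; elim: n f Hf => [|n ih] f Hf.
  apply: (@Ck_ext _ _ _ _ (fun=> 0)) => //; last exact: Ck_cst.
  by move=> x _; rewrite big_ord0.
apply: (@Ck_ext _ _ _ _ (fun x => f ord0 x + \sum_i f (lift ord0 i) x)) => //.
  by move=> x _; rewrite big_ord_recl.
by apply: Ck_add => //; exact: ih.
Qed.

Lemma Ck_S m (W : normedModType R) k (U : set 'rV[R]_m)
    (f : 'rV[R]_m -> W) : Ck k.+1 U f -> Ck k U f.
Proof.
elim: k f => [|k ih] f; first by move=> + x Ux; move=> /Ck_cont; exact.
by move=> [df Df]; split => // v; exact: ih (Df v).
Qed.

Lemma Ck_mul m k (U : set 'rV[R]_m) (f g : 'rV[R]_m -> R) :
  open U -> Ck k U f -> Ck k U g -> Ck k U (fun x => f x * g x).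
Proof.
move=> oU; elim: k f g => [|k ih] f g.
  by move=> /= cf cg x Ux; apply: continuousM; [exact: cf | exact: cg].
move=> Hf Hg; have [cf cg] := (Ck_S Hf, Ck_S Hg).
move: Hf Hg => /= [df Df] [dg Dg]; split=> [x Ux|v].
  by apply: differentiableM; [exact: df | exact: dg].
apply: (@Ck_ext _ _ _ _ (fun x => f x * 'd g x v + g x * 'd f x v)) => //.
  by move=> x Ux; rewrite diffM; [|exact: df|exact: dg].
by apply: Ck_add => //; exact: ih.
Qed.

Lemma Ck_coord m n k (U : set 'rV[R]_m) (f : 'rV[R]_m -> 'rV[R]_n) j :
  open U -> Ck k U f -> Ck k U (fun x => f x 0 j).
Proof.
move=> oU Hf.
have lL : linear (fun v : 'rV[R]_n => v 0 j) by move=> a u v; rewrite !mxE.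
pose L : {linear 'rV[R]_n -> R} := HB.pack (fun v : 'rV[R]_n => v 0 j)
  (GRing.isLinear.Build _ _ _ _ _ lL).
by apply: (@Ck_lin _ _ _ _ _ L) => //; exact: coord_continuous.
Qed.

Lemma Ck_scalel m (W : normedModType R) k (U : set 'rV[R]_m)
    (f : 'rV[R]_m -> R) (w : W) :
  open U -> Ck k U f -> Ck k U (fun x => f x *: w).
Proof.
move=> oU Hf.
have lL : linear (fun a : R => a *: w).
  by move=> a u v; rewrite scalerDl scalerA.
pose L : {linear R -> W} := HB.pack (fun a : R => a *: w)
  (GRing.isLinear.Build _ _ _ _ _ lL).
by apply: (@Ck_lin _ _ _ _ _ L) => //; exact: scalel_continuous.
Qed.

Lemma Ck_coords m n k (U : set 'rV[R]_m) (f : 'rV[R]_m -> 'rV[R]_n) :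
  open U -> (forall j, Ck k U (fun x => f x 0 j)) -> Ck k U f.
Proof.
move=> oU Hf.
apply: (@Ck_ext _ _ _ _ (fun x => \sum_j f x 0 j *: delta_mx 0 j)) => //.
  by move=> x _; rewrite -row_sum_delta.
by apply: Ck_sum => // j; exact: Ck_scalel.
Qed.

Lemma Ck_comp1 m n k (U : set 'rV[R]_m) (V : set 'rV[R]_n)
    (f : 'rV[R]_m -> 'rV[R]_n) (g : 'rV[R]_n -> R) :
  open U -> (forall x, U x -> V (f x)) ->
  Ck k U f -> Ck k V g -> Ck k U (g \o f).
Proof.
move=> oU fU; elim: k g => [|k ih] g.
  move=> /= cf cg x Ux; apply: continuous_comp; first exact: cf.
  by apply: cg; exact: fU.
move=> Hf Hg; have cf := Ck_S Hf.
move: Hf Hg => /= [df Df] [dg Dg]; split=> [x Ux|v].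
  by apply: differentiable_comp; [exact: df | apply: dg; exact: fU].
apply: (@Ck_ext _ _ _ _ (fun x => \sum_j ('d f x v) 0 j *
    ((fun y => 'd g y (delta_mx 0 j)) \o f) x)) => //.
  move=> x Ux; rewrite (diff_comp (df x Ux) (dg _ (fU x Ux))).
  rewrite /= [in RHS](row_sum_delta ('d f x v)) linear_sum.
  by apply: eq_bigr => j _; rewrite linearZ.
apply: Ck_sum => // j; apply: Ck_mul => //; last exact: ih.
by apply: (@Ck_coord _ _ _ _ (fun x => 'd f x v)).
Qed.

Lemma Ck_comp m n p k (U : set 'rV[R]_m) (V : set 'rV[R]_n)
    (f : 'rV[R]_m -> 'rV[R]_n) (g : 'rV[R]_n -> 'rV[R]_p) :
  open U -> open V -> (forall x, U x -> V (f x)) ->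
  Ck k U f -> Ck k V g -> Ck k U (g \o f).
Proof.
move=> oU oV fU Hf Hg; apply: Ck_coords => // j.
by apply: (@Ck_comp1 _ _ _ _ V _ (fun y => g y 0 j)) => //; exact: Ck_coord.
Qed.

Lemma Ck_row_mx m n p k (U : set 'rV[R]_m) (f : 'rV[R]_m -> 'rV[R]_n)
    (g : 'rV[R]_m -> 'rV[R]_p) :
  open U -> Ck k U f -> Ck k U g -> Ck k U (fun x => row_mx (f x) (g x)).
Proof.
move=> oU Hf Hg; apply: Ck_coords => // j.
case: (split_ordP j) => i ->.
  apply: (@Ck_ext _ _ _ _ (fun x => f x 0 i)) => //; last exact: Ck_coord.
  by move=> x _; rewrite row_mxEl.
apply: (@Ck_ext _ _ _ _ (fun x => g x 0 i)) => //; last exact: Ck_coord.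
by move=> x _; rewrite row_mxEr.
Qed.

End ClassCk.

Section Charts.
Variable R : realType.

(* [chart_fun] and [chart_inv] are only meaningful on [chart_dom] and
   [chart_cod], between which they are mutually inverse homeomorphisms. *)
Record chart (M : topologicalType) (m : nat) := Chart {
  chart_dom : set M;
  chart_cod : set 'rV[R]_m;
  chart_fun :> M -> 'rV[R]_m;
  chart_inv : 'rV[R]_m -> M;
  chart_dom_open : open chart_dom;
  chart_cod_open : open chart_cod;
  chart_funP : forall x, chart_dom x -> chart_cod (chart_fun x);
  chart_invP : forall y, chart_cod y -> chart_dom (chart_inv y);
  chart_funK : forall x, chart_dom x -> chart_inv (chart_fun x) = x;
  chart_invK : forall y, chart_cod y -> chart_fun (chart_inv y) = y;
  chart_fun_cont : forall x, chart_dom x -> {for x, continuous chart_fun};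
  chart_inv_cont : forall y, chart_cod y -> {for y, continuous chart_inv} }.

Arguments chart_dom_open {M m} c.
Arguments chart_cod_open {M m} c.

Variables (M N : topologicalType) (m n : nat).

Definition local_dom (c : chart M m) (f : M -> N) (c' : chart N n) :
    set 'rV[R]_m :=
  [set y | chart_cod c y /\ chart_dom c' (f (chart_inv c y))].

Definition local_expr (c : chart M m) (f : M -> N) (c' : chart N n) :
    'rV[R]_m -> 'rV[R]_n :=
  c' \o f \o chart_inv c.

Lemma local_dom_open c f c' : continuous f -> open (local_dom c f c').
Proof.
move=> cf; rewrite openE => y [cy dy].
have h1 : \forall z \near y, chart_cod c z.
  by apply: open_nbhs_nbhs; split => //; exact: chart_cod_open.
have h2 : \forall z \near y, chart_dom c' (f (chart_inv c z)).
  have c1 : {for y, continuous (f \o chart_inv c)}.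
    by apply: continuous_comp; [exact: chart_inv_cont | exact: cf].
  by apply: c1; apply: open_nbhs_nbhs; split => //; exact: chart_dom_open.
by apply: filterS2 h1 h2 => z.
Qed.

End Charts.
Arguments chart_dom_open {R M m} c.
Arguments chart_cod_open {R M m} c.

(* The atlas is not required to be maximal: it determines the structure. *)
Record manifold (R : realType) (r : option nat) (m : nat) := Manifold {
  carrier :> topologicalType;
  atlas : set (chart R carrier m);
  manifold_hausdorff : hausdorff_space carrier;
  manifold_second_countable : @second_countable carrier;
  atlas_cover : forall x : carrier, exists2 c, atlas c & chart_dom c x;
  atlas_compat : forall c c', atlas c -> atlas c' ->
    Cr r (local_dom c id c') (local_expr c id c') }.
Arguments atlas {R r m} _.

Section CrMap.
Variables (R : realType) (r : option nat).

Definition Cr_map (m n : nat) (M : manifold R r m) (N : manifold R r n)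
    (f : M -> N) : Prop :=
  continuous f /\ forall c c', atlas M c -> atlas N c' ->
    Cr r (local_dom c f c') (local_expr c f c').

Definition diffeomorphic (m n : nat) (M : manifold R r m)
    (N : manifold R r n) : Prop :=
  exists (f : M -> N) (g : N -> M),
    [/\ cancel f g, cancel g f, Cr_map f & Cr_map g].

Lemma Cr_map_id m (M : manifold R r m) : @Cr_map m m M M id.
Proof. by split=> [x A //|]; exact: atlas_compat. Qed.

Lemma Cr_map_comp m n p (M : manifold R r m) (N : manifold R r n)
    (P : manifold R r p) (f : M -> N) (g : N -> P) :
  Cr_map f -> Cr_map g -> Cr_map (g \o f).
Proof.
move=> [cf Hf] [cg Hg].
have cgf : continuous (g \o f).
  by move=> x; apply: continuous_comp; [exact: cf | exact: cg].
split=> // c c' ac ac' k kr; apply: Ck_local => y [cy dy].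
have [b ab bx] := atlas_cover (f (chart_inv c y)).
exists (local_dom c f b `&` local_dom c (g \o f) c') => //.
have oV : open (local_dom c f b `&` local_dom c (g \o f) c').
  by apply: openI; exact: local_dom_open.
apply: (@Ck_ext _ _ _ _ _ (local_expr b g c' \o local_expr c f b)) => //.
  by move=> z [[cz bz] _] /=; rewrite /local_expr /= chart_funK.
apply: (@Ck_comp _ _ _ _ _ _ (local_dom b g c')) => //.
- exact: local_dom_open.
- move=> z [[cz bz] [_ dz]]; split; first exact: chart_funP.
  by rewrite /local_expr /= chart_funK.
- by apply: (@Ck_sub _ _ _ _ (local_dom c f b)); [exact: subIsetl|exact: Hf].
- exact: Hg.
Qed.

End CrMap.

Lemma rV_continuous (R : realType) (T : topologicalType) n
    (f : T -> 'rV[R]_n) (x : T) :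
  (forall j, {for x, continuous (fun y => f y 0 j)}) -> {for x, continuous f}.
Proof.
move=> H A [P PA sPA].
have : \forall y \near x, forall j, P 0 j (f y 0 j).
  by apply: filter_forall => j; exact: H (PA 0 j).
by apply: filterS => y Py; apply: sPA => i j; rewrite (ord1 i).
Qed.

Section Euclidean.
Variables (R : realType) (r : option nat) (n : nat).

Lemma second_countable_rV : @second_countable 'rV[R]_n.
Proof.
pose b (p : 'rV[rat]_n * nat) : set 'rV[R]_n :=
  ball (map_mx ratr p.1 : 'rV[R]_n) p.2.+1%:R^-1.
exists (range b).
  by apply: sub_countable (card_image_le _ _) _; exact: countableP.
split=> [_ [p _ <-]|x A /nbhs_ballP [e /= e0 eA]]; first exact: ball_open.
have [k ke] : exists k : nat, k.+1%:R^-1 < e / 2.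
  have e20 : 0 < (e / 2)^-1 by rewrite invr_gt0 divr_gt0.
  exists (Num.truncn (e / 2)^-1).
  by rewrite invf_plt ?posrE ?divr_gt0// truncnS_gt.
pose d : R := k.+1%:R^-1.
have d0 : 0 < d by rewrite invr_gt0.
have /choice [q qP] : forall j, exists q : rat, ratr q \in `]x 0 j - d, x 0 j + d[.
  by move=> j; apply: rat_in_itvoo; rewrite ltrBlDr -addrA ltrDl addr_gt0.
pose y : 'rV[R]_n := map_mx ratr (\row_j q j).
have yx : ball y d x.
  split=> // i j; rewrite !mxE (ord1 i) /ball /= ltr_distlC.
  by have := qP j; rewrite in_itv /=; lra.
exists (ball y d); first by split=> //; exists (\row_j q j, k).
move=> z yz; apply: eA.
apply: (@le_ball _ _ _ (d + d)); first by rewrite [leRHS]splitr ltW// ltrD.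
by apply: ball_triangle yz; exact: ball_sym.
Qed.

Definition rV_chart : chart R 'rV[R]_n n :=
  @Chart R 'rV[R]_n n setT setT id id openT openT
    (fun=> id) (fun=> id) (fun _ _ => erefl) (fun _ _ => erefl)
    (fun x _ => @cvg_id _ (nbhs x)) (fun x _ => @cvg_id _ (nbhs x)).

Lemma rV_compat c c' : [set rV_chart] c -> [set rV_chart] c' ->
  Cr r (local_dom c id c') (local_expr c id c').
Proof. by move=> -> -> k _; exact: Ck_id. Qed.

Definition euclidean : manifold R r n :=
  @Manifold R r n 'rV[R]_n [set rV_chart] (@norm_hausdorff _ _)
    second_countable_rV (fun x => ex_intro2 _ _ rV_chart erefl I) rV_compat.

End Euclidean.

Section Product.
Variables (R : realType) (r : option nat).

Section ProdChart.
Variables (M N : topologicalType) (m n : nat).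
Variables (c : chart R M m) (c' : chart R N n).

Let dom : set (M * N) := [set p | chart_dom c p.1 /\ chart_dom c' p.2].
Let cod : set 'rV[R]_(m + n) :=
  [set v | chart_cod c (lsubmx v) /\ chart_cod c' (rsubmx v)].
Let to_rV (p : M * N) : 'rV[R]_(m + n) := row_mx (c p.1) (c' p.2).
Let of_rV (v : 'rV[R]_(m + n)) : M * N :=
  (chart_inv c (lsubmx v), chart_inv c' (rsubmx v)).

Lemma prod_chart_dom_open : open dom.
Proof.
apply: openI.
  by apply: open_comp (chart_dom_open c) => p _; exact: cvg_fst.
by apply: open_comp (chart_dom_open c') => p _; exact: cvg_snd.
Qed.

Lemma prod_chart_cod_open : open cod.
Proof.
apply: openI.
  apply: (open_comp _ (chart_cod_open c)) => p _.
  exact: continuous_lsubmx.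
apply: (open_comp _ (chart_cod_open c')) => p _.
exact: continuous_rsubmx.
Qed.

Lemma prod_chart_funP p : dom p -> cod (to_rV p).
Proof.
by move=> [dx dy]; rewrite /cod /= row_mxKl row_mxKr; split; exact: chart_funP.
Qed.

Lemma prod_chart_invP v : cod v -> dom (of_rV v).
Proof. by move=> [dx dy]; split; exact: chart_invP. Qed.

Lemma prod_chart_funK p : dom p -> of_rV (to_rV p) = p.
Proof.
by case: p => x y [dx dy]; rewrite /of_rV row_mxKl row_mxKr !chart_funK.
Qed.

Lemma prod_chart_invK v : cod v -> to_rV (of_rV v) = v.
Proof. by move=> [dx dy]; rewrite /to_rV !chart_invK// hsubmxK. Qed.

Lemma prod_chart_fun_cont p : dom p -> {for p, continuous to_rV}.
Proof.
move=> [dx dy]; apply: rV_continuous => j; case: (split_ordP j) => i ->.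
  rewrite (_ : (fun y => _) = (fun v : 'rV_m => v 0 i) \o (c \o fst)); last first.
    by apply/funext => y /=; rewrite row_mxEl.
  apply: continuous_comp; last exact: coord_continuous.
  by apply: continuous_comp; [exact: cvg_fst | exact: chart_fun_cont].
rewrite (_ : (fun y => _) = (fun v : 'rV_n => v 0 i) \o (c' \o snd)); last first.
  by apply/funext => y /=; rewrite row_mxEr.
apply: continuous_comp; last exact: coord_continuous.
by apply: continuous_comp; [exact: cvg_snd | exact: chart_fun_cont].
Qed.

Lemma prod_chart_inv_cont v : cod v -> {for v, continuous of_rV}.
Proof.
move=> [dx dy].
have c1 : {for v, continuous (chart_inv c \o lsubmx)}.
  by apply: continuous_comp; [exact: continuous_lsubmx|exact: chart_inv_cont].
have c2 : {for v, continuous (chart_inv c' \o rsubmx)}.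
  by apply: continuous_comp; [exact: continuous_rsubmx|exact: chart_inv_cont].
exact: cvg_pair c1 c2.
Qed.

Definition prod_chart : chart R (M * N)%type (m + n) :=
  @Chart R (M * N)%type (m + n) dom cod to_rV of_rV
    prod_chart_dom_open prod_chart_cod_open prod_chart_funP prod_chart_invP
    prod_chart_funK prod_chart_invK prod_chart_fun_cont prod_chart_inv_cont.

End ProdChart.

Lemma hausdorff_prod (M N : topologicalType) :
  hausdorff_space M -> hausdorff_space N -> hausdorff_space (M * N)%type.
Proof.
move=> hM hN [x y] [x' y'] H; congr pair.
  apply: hM => A B xA xB.
  have [] := H (A `*` setT) (B `*` setT).
  - by exists (A, setT) => //; split => //; exact: filterT.
  - by exists (B, setT) => //; split => //; exact: filterT.
  by move=> [u v] [[Au _] [Bu _]]; exists u.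
apply: hN => A B xA xB.
have [] := H (setT `*` A) (setT `*` B).
- by exists (setT, A) => //; split => //; exact: filterT.
- by exists (setT, B) => //; split => //; exact: filterT.
by move=> [u v] [[_ Au] [_ Bu]]; exists v.
Qed.

Lemma second_countable_prod (M N : topologicalType) :
  @second_countable M -> @second_countable N ->
  @second_countable (M * N)%type.
Proof.
move=> [B cB [oB bB]] [C cC [oC bC]].
exists [set p.1 `*` p.2 | p in B `*` C].
  by apply: sub_countable (card_image_le _ _) _; exact: countableX.
split=> [_ [[U V] [/= BU CV] <-]|[x y] A [[P Q] [/= xP yQ] sPQ]].
  apply: openI.
    by apply: (@open_comp _ _ fst) (oB _ BU) => p _; exact: cvg_fst.
  by apply: (@open_comp _ _ snd) (oC _ CV) => p _; exact: cvg_snd.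
have [U [BU Ux] UP] := bB x _ xP; have [V [CV Vy] VQ] := bC y _ yQ.
exists (U `*` V); first by split=> //; exists (U, V).
by move=> [u v] [/= /UP Pu /VQ Qv]; apply: sPQ.
Qed.

Section ProdManifold.
Variables (m n : nat) (M : manifold R r m) (N : manifold R r n).

Definition prod_atlas : set (chart R (M * N)%type (m + n)) :=
  [set prod_chart p.1 p.2 | p in atlas M `*` atlas N].

Lemma prod_atlas_cover (x : M * N) :
  exists2 c, prod_atlas c & chart_dom c x.
Proof.
have [c ac cx] := atlas_cover x.1; have [c' ac' cx'] := atlas_cover x.2.
by exists (prod_chart c c') => //; exists (c, c').
Qed.

Lemma Ck_lsubmx k (U : set 'rV[R]_(m + n)) : open U -> Ck k U lsubmx.
Proof. by move=> oU; apply: Ck_linear => //; exact: continuous_lsubmx. Qed.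

Lemma Ck_rsubmx k (U : set 'rV[R]_(m + n)) : open U -> Ck k U rsubmx.
Proof. by move=> oU; apply: Ck_linear => //; exact: continuous_rsubmx. Qed.

Lemma prod_atlas_compat c c' : prod_atlas c -> prod_atlas c' ->
  Cr r (local_dom c id c') (local_expr c id c').
Proof.
move=> [[a b] [/= Aa Ab] <-] [[a' b'] [/= Aa' Ab'] <-] k kr.
have oU : open (local_dom (prod_chart a b) id (prod_chart a' b')).
  by apply: local_dom_open => x A.
apply: Ck_row_mx => //.
  apply: (@Ck_comp _ _ _ _ _ _ (local_dom a id a') lsubmx (local_expr a id a')) => //.
  - by apply: local_dom_open => x A.
  - by move=> v [[? ?] [? ?]].
  - exact: Ck_lsubmx.
  - exact: atlas_compat.
apply: (@Ck_comp _ _ _ _ _ _ (local_dom b id b') rsubmx (local_expr b id b')) => //.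
- by apply: local_dom_open => x A.
- by move=> v [[? ?] [? ?]].
- exact: Ck_rsubmx.
- exact: atlas_compat.
Qed.

Definition prod_manifold : manifold R r (m + n) :=
  @Manifold R r (m + n) (M * N)%type prod_atlas
    (hausdorff_prod (@manifold_hausdorff _ _ _ M) (@manifold_hausdorff _ _ _ N))
    (second_countable_prod (@manifold_second_countable _ _ _ M)
                           (@manifold_second_countable _ _ _ N))
    prod_atlas_cover prod_atlas_compat.

Lemma Cr_map_fst : @Cr_map R r _ _ prod_manifold M fst.
Proof.
have cf : continuous (@fst M N) by move=> x; exact: cvg_fst.
split=> // c c' [[a b] [/= Aa Ab] <-] ac' k kr.
apply: (@Ck_comp _ _ _ _ _ _ (local_dom a id c') lsubmx (local_expr a id c')) => //.
- exact: local_dom_open.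
- by apply: local_dom_open => x A.
- by move=> v [[? ?] ?].
- by apply: Ck_lsubmx; exact: local_dom_open.
- exact: atlas_compat.
Qed.

Lemma Cr_map_snd : @Cr_map R r _ _ prod_manifold N snd.
Proof.
have cf : continuous (@snd M N) by move=> x; exact: cvg_snd.
split=> // c c' [[a b] [/= Aa Ab] <-] ac' k kr.
apply: (@Ck_comp _ _ _ _ _ _ (local_dom b id c') rsubmx (local_expr b id c')) => //.
- exact: local_dom_open.
- by apply: local_dom_open => x A.
- by move=> v [[? ?] ?].
- by apply: Ck_rsubmx; exact: local_dom_open.
- exact: atlas_compat.
Qed.

Lemma Cr_map_pair p (P : manifold R r p) (f : P -> M) (g : P -> N) :
  Cr_map f -> Cr_map g ->
  @Cr_map R r _ _ P prod_manifold (fun x => (f x, g x)).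
Proof.
move=> [cf Hf] [cg Hg].
have cfg : continuous (fun x => (f x, g x)).
  by move=> x; apply: cvg_pair; [exact: cf | exact: cg].
split=> // c c' ac [[a b] [/= Aa Ab] <-] k kr.
apply: Ck_row_mx; first exact: local_dom_open.
  by apply: (@Ck_sub _ _ _ _ (local_dom c f a)) => [v [? [? ?]]|]; last exact: Hf.
by apply: (@Ck_sub _ _ _ _ (local_dom c g b)) => [v [? [? ?]]|]; last exact: Hg.
Qed.

End ProdManifold.
End Product.

Section Support.
Variable T : topologicalType.
Implicit Types f g : selfbij T.

Definition support f : set T := closure [set x | f x <> x].

Lemma support1 : support 1%g = set0.
Proof. by rewrite /support (_ : [set x | _] = set0) ?closure0// -subset0. Qed.

Lemma supportV f : support f^-1%g = support f.
Proof.
congr closure; apply/seteqP; split=> x /= fx e; apply: fx.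
  by rewrite -[in LHS]e; exact: selfbijK.
by rewrite -[in LHS]e; exact: selfbijVK.
Qed.

Lemma supportM f g : support (f * g)%g `<=` support f `|` support g.
Proof.
rewrite /support -closureU; apply: closureS => x /= fgx.
have [gx|gx] := pselect (g x = x); last by right.
by left => fx; apply: fgx; rewrite /= -[RHS]fx -[in RHS]gx.
Qed.

Lemma compact_support1 : compact (support 1%g).
Proof. by rewrite support1; exact: compact0. Qed.

Lemma compact_supportM f g : compact (support f) -> compact (support g) ->
  compact (support (f * g)%g).
Proof.
move=> cf cg; apply: (subclosed_compact _ _ (@supportM f g)).
  exact: closed_closure.
exact: compactU.
Qed.

End Support.

Section Homeo.
Variables (R : realType) (Z : topologicalType).

Definition Homeo_c_set : set (selfbij Z) :=
  [set f : selfbij Z |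
    [/\ continuous f, continuous (f^-1)%g & compact (support f)]].

Lemma Homeo_c_set1 : Homeo_c_set 1%g.
Proof.
by split; [move=> x A | move=> x A | exact: compact_support1].
Qed.

Lemma Homeo_c_setM f g : Homeo_c_set f -> Homeo_c_set g ->
  Homeo_c_set (f * g)%g.
Proof.
move=> [f1 f2 f3] [g1 g2 g3]; split; last exact: compact_supportM.
  by move=> x; apply: (@continuous_comp _ _ _ g f); [exact: g1|exact: f1].
by move=> x; apply: (@continuous_comp _ _ _ f^-1%g g^-1%g);
  [exact: f2|exact: g2].
Qed.

Lemma Homeo_c_setV f : Homeo_c_set f -> Homeo_c_set (f^-1)%g.
Proof. by move=> [f1 f2 f3]; split => //; rewrite supportV. Qed.

Definition Homeo_c : subgroup (selfbij Z) :=
  Subgroup Homeo_c_set1 Homeo_c_setM Homeo_c_setV.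

(* The isotopies are supported in a compact set independent of the time:
   they are the paths of the inductive limit topology on [Homeo_c]. *)
Definition Homeo_c0_set : set (selfbij Z) :=
  [set f : selfbij Z | exists (H : R -> selfbij Z) (K : set Z),
    [/\ compact K,
        {within [set: Z] `*` `[0, 1], continuous (fun p : Z * R => H p.2 p.1)},
        forall t : R, t \in `[0, 1] -> Homeo_c_set (H t) /\ support (H t) `<=` K,
        H 0 = 1%g
      & H 1 = f]].

Lemma Homeo_c0_set1 : Homeo_c0_set 1%g.
Proof.
exists (fun=> 1%g), set0; split => //; first exact: compact0.
  apply: continuous_subspaceT => p; exact: cvg_fst.
by move=> t _; rewrite support1; split => //; exact: Homeo_c_set1.
Qed.

Lemma Homeo_c0_setM f g : Homeo_c0_set f -> Homeo_c0_set g ->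
  Homeo_c0_set (f * g)%g.
Proof.
move=> [F [K [cK cF FP F0 F1]]] [G [L [cL cG GP G0 G1]]].
exists (fun t => F t * G t)%g, (K `|` L); split.
- exact: compactU.
- apply/subspace_continuousP => -[x t] /= xt.
  move/subspace_continuousP : cF => /(_ (G t x, t) xt) cF.
  move/subspace_continuousP : cG => /(_ (x, t) xt) cG.
  have c2 : (@snd Z R) @ within ([set: Z] `*` `[0, 1]) (nbhs (x, t)) --> t.
    move=> A tA; have : nbhs (x, t) (snd @^-1` A) by exact: cvg_snd.
    by apply: filterS => p Ap _.
  have c1 : (fun p : Z * R => (G p.2 p.1, p.2)) @
      within ([set: Z] `*` `[0, 1]) (nbhs (x, t)) --> nbhs (G t x, t).
    exact: (cvg_pair cG c2).
  apply: (@cvg_comp _ _ _ (fun p : Z * R => (G p.2 p.1, p.2))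
    (fun p => F p.2 p.1) _ _ _ _ cF).
  move=> A /= wA; have := c1 _ wA; rewrite /fmap /= /within /=.
  by rewrite !nbhs_filterE /=; apply: filterS => -[y s] /= H ys; exact: H.
- move=> t t01; have [Ft FtK] := FP t t01; have [Gt GtL] := GP t t01.
  split; first exact: Homeo_c_setM.
  by apply: subset_trans (@supportM _ _ _) _; exact: setUSS.
- by rewrite F0 G0 mulg1.
- by rewrite F1 G1.
Qed.

Lemma Homeo_c0_setV f : Homeo_c0_set f -> Homeo_c0_set (f^-1)%g.
Proof.
move=> [F [K [cK cF FP F0 F1]]].
have [Hf fK] : Homeo_c_set f /\ support f `<=` K.
  by rewrite -F1; apply: FP; rewrite in_itv /= ler01 lexx.
have [f1 f2 f3] := Hf.
exists (fun t => F (1 - t) * f^-1)%g, (K `|` K); split.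
- exact: compactU.
- apply/subspace_continuousP => -[x t] /= [_ t01].
  have xt : ([set: Z] `*` `[0, 1]) (f^-1%g x, 1 - t).
    by split=> //=; move: t01; rewrite /= !in_itv /=; lra.
  move/subspace_continuousP : cF => /(_ _ xt) cF.
  have c2 : (fun p : Z * R => f^-1%g p.1) @ nbhs (x, t) --> f^-1%g x.
    apply: (@cvg_comp _ _ _ (@fst Z R) (f^-1%g : Z -> Z) _ (nbhs x)).
      exact: cvg_fst.
    exact: f2.
  have c3 : (fun p : Z * R => 1 - p.2) @ nbhs (x, t) --> 1 - t.
    by apply: cvgB; [exact: cvg_cst|exact: cvg_snd].
  have c1 : (fun p : Z * R => (f^-1%g p.1, 1 - p.2)) @ nbhs (x, t) -->
      nbhs (f^-1%g x, 1 - t).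
    exact: (cvg_pair c2 c3).
  apply: (@cvg_comp _ _ _ (fun p : Z * R => (f^-1%g p.1, 1 - p.2))
    (fun p => F p.2 p.1) _ _ _ _ cF).
  move=> A /= wA; have := c1 _ wA; rewrite /fmap /= /within /=.
  rewrite !nbhs_filterE /=; apply: filterS => -[y s] /= H [_ s01].
  by apply: H; split=> //=; move: s01; rewrite /= !in_itv /=; lra.
- move=> t t01.
  have [Ft FtK] : Homeo_c_set (F (1 - t)) /\ support (F (1 - t)) `<=` K.
    by apply: FP; move: t01; rewrite !in_itv /=; lra.
  split; first by apply: Homeo_c_setM => //; exact: Homeo_c_setV.
  apply: subset_trans (@supportM _ _ _) _; apply: setUSS => //.
  by rewrite supportV.
- by rewrite subr0 F1 mulgV.
- by rewrite subrr F0 mul1g.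
Qed.

Definition Homeo_c0 : subgroup (selfbij Z) :=
  Subgroup Homeo_c0_set1 Homeo_c0_setM Homeo_c0_setV.

End Homeo.

Section Diff.
Variables (R : realType) (r : option nat) (m : nat) (Z : manifold R r m).

Definition Diff_c_set : set (selfbij Z) :=
  [set f : selfbij Z |
    [/\ Cr_map (f : Z -> Z), Cr_map ((f^-1)%g : Z -> Z) & compact (support f)]].

Lemma Diff_c_set1 : Diff_c_set 1%g.
Proof.
by split; [exact: Cr_map_id | exact: Cr_map_id | exact: compact_support1].
Qed.

Lemma Diff_c_setM f g : Diff_c_set f -> Diff_c_set g -> Diff_c_set (f * g)%g.
Proof.
move=> [f1 f2 f3] [g1 g2 g3]; split; last exact: compact_supportM.
  exact: Cr_map_comp g1 f1.
exact: Cr_map_comp f2 g2.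
Qed.

Lemma Diff_c_setV f : Diff_c_set f -> Diff_c_set (f^-1)%g.
Proof. by move=> [f1 f2 f3]; split => //; rewrite supportV. Qed.

Definition Diff_c : subgroup (selfbij Z) :=
  Subgroup Diff_c_set1 Diff_c_setM Diff_c_setV.

(* The isotopy [H] is of class $C^r$ on $Z \times [0, 1]$, in the sense that it
   extends to a map [F] of class $C^r$ on $Z \times \mathbf{R}$. For $r = 0$
   this is continuity on $Z \times [0, 1]$. *)
Definition Diff_c0_set : set (selfbij Z) :=
  [set f : selfbij Z | exists (H : R -> selfbij Z) (F : Z * 'rV[R]_1 -> Z) (K : set Z),
    [/\ compact K,
        Cr_map (F : prod_manifold Z (euclidean R r 1) -> Z),
        forall t : R, t \in `[0, 1] ->
          [/\ Diff_c_set (H t), support (H t) `<=` K &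
              forall x, H t x = F (x, const_mx t)],
        H 0 = 1%g
      & H 1 = f]].

Lemma Diff_c0_set1 : Diff_c0_set 1%g.
Proof.
exists (fun=> 1%g), fst, set0; split => //.
- exact: compact0.
- exact: Cr_map_fst.
- by move=> t _; rewrite support1; split => //; exact: Diff_c_set1.
Qed.

Lemma Diff_c0_setM f g : Diff_c0_set f -> Diff_c0_set g ->
  Diff_c0_set (f * g)%g.
Proof.
move=> [H1 [F [K [cK cF FP F0 F1]]]] [H2 [G [L [cL cG GP G0 G1]]]].
exists (fun t => H1 t * H2 t)%g, (fun p => F (G p, p.2)), (K `|` L); split.
- exact: compactU.
- exact: (Cr_map_comp (Cr_map_pair cG (@Cr_map_snd _ _ _ _ _ _)) cF).
- move=> t t01; have [Ft FtK FE] := FP t t01; have [Gt GtL GE] := GP t t01.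
  split; first exact: Diff_c_setM.
    by apply: subset_trans (@supportM _ _ _) _; exact: setUSS.
  by move=> x; rewrite /= -GE -FE.
- by rewrite F0 G0 mulg1.
- by rewrite F1 G1.
Qed.

Lemma Cr_map_onem :
  @Cr_map R r 1 1 (euclidean R r 1) (euclidean R r 1)
    (fun v => const_mx 1 - v).
Proof.
have Hk k (U : set 'rV[R]_1) : open U -> Ck k U (fun v => const_mx 1 - v).
  move=> oU; apply: Ck_add => //; first exact: Ck_cst.
  by apply: Ck_linear => // x; exact: oppr_continuous.
split=> [x|c c' -> -> k _].
  by apply: (@Ck_cont _ _ _ 0 setT) => //; apply: Hk; exact: openT.
by apply: (@Ck_sub _ _ _ _ setT) => //; exact: Hk openT.
Qed.

Lemma Diff_c0_setV f : Diff_c0_set f -> Diff_c0_set (f^-1)%g.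
Proof.
move=> [H [F [K [cK cF FP F0 F1]]]].
have [Hf fK _] : [/\ Diff_c_set f, support f `<=` K &
    forall x, f x = F (x, const_mx 1)].
  by rewrite -F1; apply: FP; rewrite in_itv /= ler01 lexx.
have [f1 f2 f3] := Hf.
exists (fun t => H (1 - t) * f^-1)%g,
  (fun p => F (f^-1%g p.1, const_mx 1 - p.2)), (K `|` K); split.
- exact: compactU.
- apply: (Cr_map_comp _ cF); apply: Cr_map_pair.
    exact: Cr_map_comp (@Cr_map_fst _ _ _ _ _ _) f2.
  exact: Cr_map_comp (@Cr_map_snd _ _ _ _ _ _) Cr_map_onem.
- move=> t t01.
  have /FP [Ft FtK FE] : 1 - t \in `[0, 1].
    by move: t01; rewrite !in_itv /=; lra.
  split; first by apply: Diff_c_setM => //; exact: Diff_c_setV.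
    apply: subset_trans (@supportM _ _ _) _; apply: setUSS => //.
    by rewrite supportV.
  move=> x; rewrite /= FE; congr (F (_, _)).
  by apply/matrixP => i j; rewrite !mxE.
- by rewrite subr0 F1 mulgV.
- by rewrite subrr F0 mul1g.
Qed.

Definition Diff_c0 : subgroup (selfbij Z) :=
  Subgroup Diff_c0_set1 Diff_c0_setM Diff_c0_setV.

End Diff.

(* Main.v *)
Require Import Defs.
From HB Require Import structures.
From mathcomp Require Import all_boot all_order all_algebra.
From mathcomp Require Import ring lra.
From mathcomp Require Import all_classical all_reals all_analysis.

(* Proof idea. For an abstract group G, assume that every finite subset S of G
   commutes elementwise with some conjugate of itself; then G is boundedly
   acyclic. Indeed, iterating, there are t_0, ..., t_(N-1) such that the sets
   S^(t_i) commute pairwise. Spread independent random letters, each trivial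
   with high probability and otherwise in S, over these N sites; this gives
   random elements w_0, ..., w_m of G. Given a bounded cocycle f, replace
   f(g_0, ..., g_m) by the mean of f(g_0 t_k w_0, ..., g_m t_k w_m), where k is
   uniform and independent of the w_j. The prism operator shows that this only
   changes f by a coboundary with a uniform bound. By invariance the new value
   is the mean of f(g_0^(t_k) w_0, ..., g_m^(t_k) w_m), in which the letters at
   the site k are replaced by the g_j. By the weak law of large numbers one such
   replacement at a random site does not affect the law of (w_0, ..., w_m) for N
   large, so the new cochain is almost constant on S^(m+1). A limit along an
   ultrafilter on the finite subsets S shows that f is a bounded coboundary.

   On M x R^n the conjugating elements come from displacement: pushing along the
   first coordinate of R^n by a small bump function is a compactly supported
   diffeomorphism isotopic to the identity, and some power of it carries a given
   compact set off itself. This one element lies in all four groups. *)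

Set Implicit Arguments.
Unset Strict Implicit.
Unset Printing Implicit Defensive.

Import Order.TTheory GRing.Theory Num.Theory.
Import numFieldNormedType.Exports.
Local Open Scope classical_set_scope.
Local Open Scope ring_scope.

(** * Cochains on finite sequences *)

Section SeqCochains.
Variable R : realFieldType.

(** The homogeneous coboundary on sequences of every length. Recursion on the first entry allows
    induction on the list; [seq_codiffE] recovers the alternating sum. *)
Fixpoint seq_codiff (T : Type) (F : seq T -> R) (s : seq T) : R :=
  if s is a :: s' then F s' - seq_codiff (fun u => F (a :: u)) s' else 0.

(* On the list of pairs [(x_0, y_0), ..., (x_n, y_n)] this is the alternating
   sum of the [F (y_0, ..., y_i, x_i, ..., x_n)]. *)
Fixpoint prism (T : Type) (F : seq T -> R) (s : seq (T * T)) : R :=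
  if s is (x, y) :: s' then
    F (y :: x :: map fst s') - prism (fun u => F (y :: u)) s'
  else 0.

Lemma seq_codiffB T (F F' : seq T -> R) s :
  seq_codiff (fun u => F u - F' u) s = seq_codiff F s - seq_codiff F' s.
Proof.
elim: s F F' => /= [|a s ih] F F'; first by rewrite subr0.
by rewrite ih; ring.
Qed.

Lemma seq_codiff_map T U (f : T -> U) (F : seq U -> R) s :
  seq_codiff (fun u => F (map f u)) s = seq_codiff F (map f s).
Proof. by elim: s F => //= a s ih F; rewrite -ih. Qed.

Lemma seq_codiffE T (F : seq T -> R) s :
  seq_codiff F s =
  \sum_(i < size s) (-1) ^+ i * F (take i s ++ drop i.+1 s).
Proof.
elim: s F => [|a s ih] F; first by rewrite big_ord0.
rewrite big_ord_recl /= ih expr0 mul1r drop0 -sumrN; congr (_ + _).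
by apply: eq_bigr => i _; rewrite exprS mulN1r mulNr.
Qed.

Lemma seq_codiff_sum T (I : finType) (F : I -> seq T -> R) s :
  seq_codiff (fun u => \sum_i F i u) s = \sum_i seq_codiff (F i) s.
Proof.
rewrite (eq_bigr _ (fun i _ => seq_codiffE (F i) s)) exchange_big seq_codiffE.
by apply: eq_bigr => j _; rewrite mulr_sumr.
Qed.

Lemma seq_codiffZ T k (F : seq T -> R) s :
  seq_codiff (fun u => k * F u) s = k * seq_codiff F s.
Proof.
rewrite !seq_codiffE mulr_sumr; apply: eq_bigr => i _.
by rewrite mulrCA.
Qed.

Lemma eq_prism T (F F' : seq T -> R) : F =1 F' -> prism F =1 prism F'.
Proof.
move=> eF s; elim: s F F' eF => //= -[x y] s ih F F' eF.
by rewrite eF; congr (_ - _); apply: ih => u; exact: eF.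
Qed.

Lemma prismB T (F F' : seq T -> R) s :
  prism (fun u => F u - F' u) s = prism F s - prism F' s.
Proof.
elim: s F F' => /= [|[x y] s ih] F F'; first by rewrite subr0.
by rewrite ih; ring.
Qed.

(** The prism operator is a chain homotopy between the two projections of pairs. In the induction
    the terms with [y] and [x] both at the head cancel, and so do the two copies of [prism F s]. *)
Lemma prism_homotopy T (F : seq T -> R) s :
  seq_codiff (prism F) s + prism (seq_codiff F) s =
  F (map fst s) - F (map snd s).
Proof.
elim: s F => [|[x y] s ih] F /=; first by rewrite addr0 subrr.
rewrite seq_codiffB (seq_codiff_map fst (fun u => F (y :: x :: u))).
rewrite (prismB F (seq_codiff (fun u => F (y :: u)))).
have := ih (fun u => F (y :: u)); lra.
Qed.

Lemma prism0 T (F : seq T -> R) s : (forall u, F u = 0) -> prism F s = 0.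
Proof.
elim: s F => //= -[x y] s ih F F0.
by rewrite F0 ih ?subrr// => u; exact: F0.
Qed.

Lemma prism_map T U (f : T -> U) (F : seq U -> R) s :
  prism (fun u => F (map f u)) s =
  prism F (map (fun p => (f p.1, f p.2)) s).
Proof.
elim: s F => //= -[x y] s ih F /=.
by rewrite -ih /= -!map_comp.
Qed.

Lemma prism_bounded T (F : seq T -> R) (C : R) s :
  (forall u, `|F u| <= C) -> `|prism F s| <= C * (size s)%:R.
Proof.
elim: s F => /= [|[x y] s ih] F bF; first by rewrite normr0 mulr0.
apply: le_trans (ler_normB _ _) _; rewrite -natr1 mulrDr mulr1 addrC.
by apply: lerD => //; exact: ih.
Qed.

End SeqCochains.

(** * Averages *)

Section Average.
Variables (R : realFieldType) (W : finType).
Hypothesis W_gt0 : (0 < #|W|)%N.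

Definition avg (f : W -> R) : R := #|W|%:R^-1 * \sum_w f w.

Let cardW_neq0 : #|W|%:R != 0 :> R.
Proof. by rewrite pnatr_eq0 -lt0n. Qed.

Lemma avg_cst c : avg (fun=> c) = c.
Proof. by rewrite /avg sumr_const -[c *+ _]mulr_natl mulKf. Qed.

Lemma eq_avg f f' : f =1 f' -> avg f = avg f'.
Proof. by move=> ef; congr (_ * _); exact: eq_bigr. Qed.

Lemma avgB f f' : avg (fun w => f w - f' w) = avg f - avg f'.
Proof. by rewrite /avg big_split/= sumrN; ring. Qed.

Lemma avgD f f' : avg (fun w => f w + f' w) = avg f + avg f'.
Proof. by rewrite /avg big_split/= mulrDr. Qed.

Lemma avgZ c f : avg (fun w => c * f w) = c * avg f.
Proof. by rewrite /avg -mulr_sumr mulrCA. Qed.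

Lemma le_avg f f' : (forall w, f w <= f' w) -> avg f <= avg f'.
Proof. by move=> ff'; rewrite ler_wpM2l ?invr_ge0// ler_sum. Qed.

Lemma avg_norm f : `|avg f| <= avg (fun w => `|f w|).
Proof.
by rewrite normrM ger0_norm ?invr_ge0// ler_wpM2l ?invr_ge0// ler_norm_sum.
Qed.

Lemma avg_bounded f C : (forall w, `|f w| <= C) -> `|avg f| <= C.
Proof.
by move=> fC; rewrite (le_trans (avg_norm f))// -[leRHS]avg_cst le_avg.
Qed.

Variables (T U : Type) (v : T -> W -> U).

(* The vertices [g] of the sequence are replaced by [v g w] with an independent
   uniform [w] for each of them. *)
Fixpoint seq_avg (Q : seq U -> R) (s : seq T) : R :=
  if s is g :: s' then
    avg (fun w => seq_avg (fun u => Q (v g w :: u)) s')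
  else Q [::].

Lemma eq_seq_avg Q Q' : Q =1 Q' -> seq_avg Q =1 seq_avg Q'.
Proof.
move=> eQ s; elim: s Q Q' eQ => //= a s ih Q Q' eQ.
by apply: eq_avg => w; apply: ih => u; exact: eQ.
Qed.

Lemma seq_avgB Q Q' s :
  seq_avg (fun u => Q u - Q' u) s = seq_avg Q s - seq_avg Q' s.
Proof.
elim: s Q Q' => //= a s ih Q Q'.
by rewrite -avgB; apply: eq_avg => w; rewrite ih.
Qed.

Lemma seq_avg_bounded Q C s : (forall u, size u = size s -> `|Q u| <= C) ->
  `|seq_avg Q s| <= C.
Proof.
elim: s Q => [|a s ih] Q bQ /=; first exact: bQ.
by apply: avg_bounded => w; apply: ih => u us; apply: bQ; rewrite /= us.
Qed.

(** The letters are independent, so when a vertex is omitted the average over its letter acts on a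
    constant. *)
Lemma seq_codiff_avg Q s :
  seq_codiff (seq_avg Q) s = seq_avg (seq_codiff Q) s.
Proof.
elim: s Q => //= a s ih Q.
rewrite (eq_avg (fun w => seq_avgB _ _ _)) avgB avg_cst; congr (_ - _).
rewrite seq_codiffZ seq_codiff_sum; congr (_ * _).
by apply: eq_bigr => w _; exact: ih.
Qed.

Lemma seq_avg_pred (k : U -> T) F s : (forall g w, k (v g w) = g) ->
  seq_avg (fun u => F (map k u)) s = F s.
Proof.
move=> kv; elim: s F => //= a s ih F.
rewrite (@eq_avg _ (fun=> F (a :: s))) ?avg_cst// => w.
by rewrite (ih (fun u => F (k (v a w) :: u))) kv.
Qed.

Lemma seq_avg_map (f : T -> T) (f' : U -> U) Q s :
  (forall g w, v (f g) w = f' (v g w)) ->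
  seq_avg Q (map f s) = seq_avg (fun u => Q (map f' u)) s.
Proof.
move=> vf; elim: s Q => //= a s ih Q.
by apply: eq_avg => w; rewrite ih vf.
Qed.

End Average.

(** * Random functions with one value replaced *)

Section SiteReplacement.
Variable R : realFieldType.

(** Independence of the values of a uniform random function. *)
Lemma avg_prod (I A : finType) (h : I -> A -> R) :
  avg (fun w : {ffun I -> A} => \prod_i h i (w i)) = \prod_i avg (h i).
Proof.
rewrite /avg -bigA_distr_bigA big_split/= prodr_const card_ffun.
by rewrite natrX exprVn.
Qed.

Lemma avg_marginal (I A : finType) (i : I) (h : A -> R) :
  (0 < #|A|)%N -> avg (fun w : {ffun I -> A} => h (w i)) = avg h.
Proof.
move=> A0; pose H j := if j == i then h else fun=> 1.
transitivity (avg (fun w : {ffun I -> A} => \prod_j H j (w j))).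
  apply: eq_avg => w; rewrite (bigD1 i)//= /H eqxx big1 ?mulr1// => j /negbTE.
  by move=> ->.
rewrite avg_prod (bigD1 i)//= /H eqxx big1 ?mulr1// => j /negbTE ->.
by rewrite avg_cst.
Qed.

Lemma avg_marginal2 (I A : finType) (i j : I) (h h' : A -> R) :
  (0 < #|A|)%N -> i != j ->
  avg (fun w : {ffun I -> A} => h (w i) * h' (w j)) = avg h * avg h'.
Proof.
move=> A0 ij; pose H l := if l == i then h else if l == j then h' else fun=> 1.
transitivity (avg (fun w : {ffun I -> A} => \prod_l H l (w l))).
  apply: eq_avg => w; rewrite (bigD1 i)//= (bigD1 j) 1?eq_sym//= /H.
  rewrite eqxx eq_sym (negbTE ij) eqxx big1 ?mulr1// => l.
  by move=> /andP[/negbTE -> /negbTE ->].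
rewrite avg_prod (bigD1 i)//= (bigD1 j) 1?eq_sym//= /H.
rewrite eqxx eq_sym (negbTE ij) eqxx big1 ?mulr1// => l.
by move=> /andP[/negbTE -> /negbTE ->]; rewrite avg_cst.
Qed.

Definition replace (I : finType) (A : Type) (w : {ffun I -> A}) k a :
  {ffun I -> A} := [ffun i => if i == k then a else w i].

(** Forcing the value [a] at [k] weights the uniform law by a density, since each [w] with [w k = a]
    arises from exactly [#|A|] functions. *)
Lemma avg_replace (I A : finType) (k : I) (a : A) (F : {ffun I -> A} -> R) :
  avg (fun w => F (replace w k a)) =
  avg (fun w => F w * (#|A|%:R * (w k == a)%:R)).
Proof.
congr (_ * _).
rewrite (partition_big (fun w => replace w k a) (fun w => w k == a)) /=;
    last first.
  by move=> w _; rewrite ffunE eqxx.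
rewrite [RHS](bigID (fun w : {ffun I -> A} => w k == a)) /=.
rewrite [X in _ + X]big1 ?addr0; last first.
  by move=> w /negbTE ->; rewrite !mulr0.
apply: eq_bigr => w /eqP wk.
(* The fibre over [w] is parametrised by the erased value at [k]. *)
rewrite (reindex_onto (fun b => replace w k b)
  (fun u : {ffun I -> A} => u k)) /=; last first.
  move=> u /eqP uw; apply/ffunP => i; rewrite ffunE; case: eqVneq => [->//|ik].
  by rewrite -uw ffunE (negbTE ik).
rewrite (eq_bigr (fun=> F w)) => [|b /andP[/eqP -> _]//].
rewrite (eq_bigl predT) => [|b]; last first.
  rewrite !ffunE eqxx eqxx andbT; apply/eqP/ffunP => i.
  by rewrite !ffunE; case: eqVneq => // ->.
by rewrite sumr_const wk eqxx mulr1 -[F w *+ _]mulr_natr.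
Qed.

(* The sites are independent, so the average over [k] of the densities
   [#|A| * (w k == a)] of the replacements has variance at most [#|A| / N]
   around [1]. *)
Lemma replace_average (N : nat) (A : finType) (a : A)
    (F : {ffun 'I_N -> A} -> R) (C e : R) :
  (0 < N)%N -> (forall w, `|F w| <= C) -> 0 < e -> #|A|%:R <= N%:R * e ^+ 2 ->
  `|avg (fun k => avg (fun w => F (replace w k a))) - avg F| <= C * e.
Proof.
move=> N0 FC e0 AN; have A0 : (0 < #|A|)%N by apply/card_gt0P; exists a.
have NR0 : 0 < N%:R :> R by rewrite ltr0n.
have W0 : (0 < #|{ffun 'I_N -> A}|)%N.
  by apply/card_gt0P; exists [ffun=> a].
have C0 : 0 <= C by apply: le_trans (FC [ffun=> a]).
(* The centred density at one site; it has mean 0 and variance [#|A| - 1]. *)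
pose phi b : R := #|A|%:R * (b == a)%:R - 1.
have phi_a : \sum_b #|A|%:R * (b == a)%:R = #|A|%:R :> R.
  rewrite (bigD1 a)//= eqxx mulr1 big1 ?addr0// => b /negbTE ->.
  by rewrite mulr0.
have AR0 : #|A|%:R != 0 :> R by rewrite pnatr_eq0 -lt0n.
have phi0 : avg phi = 0.
  rewrite avgB avg_cst// /avg phi_a mulVf ?subrr//.
have phi2 : avg (fun b => phi b * phi b) = #|A|%:R - 1.
  transitivity (avg (fun b => #|A|%:R * (#|A|%:R * (b == a)%:R) -
      (#|A|%:R * (b == a)%:R - (1 - #|A|%:R * (b == a)%:R)) : R)).
    by apply: eq_avg => b; rewrite /phi; case: eqP => _ /=; ring.
  rewrite avgB avgB avgB avg_cst// /avg -mulr_sumr phi_a mulVf//.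
  by field.
pose S (w : {ffun 'I_N -> A}) : R := \sum_k phi (w k).
(* In the expanded square the cross terms vanish, because distinct sites are independent and [phi]
   has mean 0. *)
have S2 : avg (fun w => S w ^+ 2) = N%:R * (#|A|%:R - 1).
  transitivity (\sum_(k < N) \sum_(l < N)
      avg (fun w : {ffun 'I_N -> A} => phi (w k) * phi (w l))).
    rewrite /avg; under [in RHS]eq_bigr do rewrite -mulr_sumr exchange_big.
    rewrite -mulr_sumr exchange_big/=; congr (_ * _); apply: eq_bigr => w _.
    by rewrite expr2 /S mulr_suml; apply: eq_bigr => k _; rewrite mulr_sumr.
  rewrite (eq_bigr (fun=> #|A|%:R - 1)) => [|k _].
    by rewrite sumr_const card_ord mulr_natl.
  rewrite (bigD1 k)//= big1 ?addr0 => [|l lk].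
    by rewrite (avg_marginal k (fun b => phi b * phi b)).
  by rewrite avg_marginal2 1?eq_sym// phi0 mul0r.
have -> : avg (fun k => avg (fun w => F (replace w k a))) - avg F =
    avg (fun w => F w * (S w / N%:R)).
  have -> : avg (fun k => avg (fun w => F (replace w k a))) =
      avg (fun w => F w * (S w / N%:R) + F w).
    rewrite {1}/avg card_ord.
    under eq_bigr do rewrite avg_replace.
    rewrite /avg -mulr_sumr mulrCA; congr (_ * _).
    rewrite exchange_big mulr_sumr; apply: eq_bigr => w _ /=.
        rewrite -mulr_sumr mulrCA -[X in _ + X]mulr1 -mulrDr; congr (_ * _).
    rewrite /S big_split/= sumr_const card_ord mulNrn.
    by field; rewrite lt0r_neq0.
  by rewrite -avgB; apply: eq_avg => w; rewrite addrK.
have -> : C * e = C * ((e + e) / 2) by field.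
apply: le_trans (avg_norm _) _.
(* With [x = S w / N], the inequality [2 |x| <= x ^ 2 / e + e] replaces Cauchy-Schwarz and leaves
   only the second moment. *)
apply: (@le_trans _ _ (avg (fun w =>
    C * (((N%:R ^+ 2 * e)^-1 * S w ^+ 2 + e) / 2)))).
  apply: le_avg => w; rewrite normrM; apply: ler_pM => //.
  set x := S w / _; have -> : (N%:R ^+ 2 * e)^-1 * S w ^+ 2 = x ^+ 2 / e.
    by rewrite /x; field; rewrite !lt0r_neq0.
  have : 0 <= (`|x| - e) ^+ 2 / e by rewrite divr_ge0 ?sqr_ge0// ltW.
  have -> : (`|x| - e) ^+ 2 / e = x ^+ 2 / e + e - 2 * `|x|.
    rewrite -(real_normK (num_real x)); field; exact: lt0r_neq0.
  lra.
rewrite (eq_avg (_ : _ =1 fun w =>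
    C / 2 * (N%:R ^+ 2 * e)^-1 * S w ^+ 2 + C * e / 2)) => [|w]; last by ring.
rewrite avgD avgZ avg_cst//.
have -> : C * ((e + e) / 2) = C / 2 * e + C * e / 2 by field.
rewrite -[X in X + _ <= _]mulrA lerD2r ler_wpM2l ?divr_ge0//.
rewrite S2.
have -> : (N%:R ^+ 2 * e)^-1 * (N%:R * (#|A|%:R - 1)) =
    (#|A|%:R - 1) / (N%:R * e).
  by field; rewrite !lt0r_neq0.
rewrite ler_pdivrMr ?mulr_gt0//; apply: le_trans (_ : #|A|%:R <= _); first lra.
by apply: le_trans AN _; rewrite mulrCA.
Qed.

End SiteReplacement.

(** * Reindexing averages *)

Section Reindexing.
Variable R : realFieldType.

Lemma avg_reindex (X Y : finType) (h : X -> Y) (f : Y -> R) :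
  bijective h -> avg (fun x => f (h x)) = avg f.
Proof.
move=> bh; rewrite /avg (bij_eq_card bh); congr (_ * _).
by rewrite [RHS](reindex h) //=; exact: onW_bij.
Qed.

Lemma avg_exchange (X Y : finType) (f : X -> Y -> R) :
  avg (fun x => avg (f x)) = avg (fun p : X * Y => f p.1 p.2).
Proof.
by rewrite /avg -mulr_sumr pair_big mulrA card_prod natrM invfM.
Qed.

Definition ffun_cons m (A : Type) (p : A * {ffun 'I_m -> A}) :
    {ffun 'I_m.+1 -> A} :=
  [ffun j => oapp p.2 p.1 (unlift ord0 j)].

Lemma ffun_cons_bij m (A : Type) : bijective (@ffun_cons m A).
Proof.
exists (fun u : {ffun 'I_m.+1 -> A} =>
  (u ord0, [ffun j => u (lift ord0 j)]) : A * {ffun 'I_m -> A}) => [[a u]|u].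
  congr (_, _); first by rewrite ffunE unlift_none.
  by apply/ffunP => j; rewrite !ffunE liftK.
by apply/ffunP => j; rewrite ffunE; case: unliftP => [i|] -> //=; rewrite ffunE.
Qed.

(** Turns the iterated average into a single one over functions from vertices to letters, which can
    then be reindexed. *)
Lemma seq_avg_ffun m (W : finType) (T U : Type) (v : T -> W -> U)
    (Q : seq U -> R) (g : 'I_m -> T) :
  (0 < #|W|)%N ->
  seq_avg v Q [seq g j | j <- enum 'I_m] =
  avg (fun u : {ffun 'I_m -> W} => Q [seq v (g j) (u j) | j <- enum 'I_m]).
Proof.
move=> W0; elim: m g Q => [|m ih] g Q.
  rewrite enum_ord0 /= avg_cst// card_ffun card_ord//.
rewrite -(avg_reindex _ (@ffun_cons_bij m W)).
rewrite -(avg_exchange (fun w u =>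
  Q [seq v (g j) (ffun_cons (w, u) j) | j <- enum 'I_m.+1])).
rewrite enum_ordSl /= -map_comp; apply: eq_avg => w; rewrite ih.
apply: eq_avg => u; congr Q; rewrite !ffunE unlift_none /=; congr (_ :: _).
by rewrite -map_comp; apply: eq_map => j /=; rewrite ffunE liftK.
Qed.

(** Words are drawn vertex by vertex, while a replacement changes one site for all vertices at once;
    the flip passes between the two. *)
Definition ffun_flip (I J : finType) (A : Type) (u : {ffun I -> {ffun J -> A}}) :
  {ffun J -> {ffun I -> A}} := [ffun j => [ffun i => u i j]].

Lemma ffun_flip_bij I J A : bijective (@ffun_flip I J A).
Proof.
by exists (@ffun_flip J I A) => u; apply/ffunP => i; apply/ffunP => j;
  rewrite !ffunE.
Qed.

End Reindexing.

(** The factor [x] commutes past everything in front of slot [k], where it takes the place of a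
    trivial factor. *)
Lemma prod_insert (G : groupType) (I : eqType) (r : seq I) (k : I) (x : G)
    (h : I -> G) :
  uniq r -> k \in r -> h k = 1%g -> (forall i, i != k -> commute x (h i)) ->
  (x * \prod_(i <- r) h i)%g = (\prod_(i <- r) (if i == k then x else h i))%g.
Proof.
move=> + + hk xh; elim: r => //= a r ih /andP[ar ur].
rewrite inE !big_cons; have [ka _|ka /= kr] := eqVneq k a.
  rewrite -ka hk mul1g; congr (_ * _)%g; apply: eq_big_seq => i ir.
  by case: eqVneq => // ik; move: ar; rewrite -ka -ik ir.
by rewrite mulgA xh 1?eq_sym// -mulgA ih.
Qed.

(** * Groups with commuting conjugates *)

Section DisplacedAverage.
Variables (R : realFieldType) (G : groupType) (N D : nat).
Variables (S : seq G) (sigma : 'I_N -> G) (F : seq G -> R) (C : R).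
Hypothesis sigma_commute : forall i j, i != j ->
  forall x y, x \in S -> y \in S -> commute (x ^ sigma i)%g (y ^ sigma j)%g.
Hypothesis N_gt0 : (0 < N)%N.
Hypothesis D_gt0 : (0 < D)%N.
Hypothesis S_le : (size S <= D)%N.
Hypothesis F_bounded : forall s, `|F s| <= C.
Hypothesis F_invariant : forall x s, F (map (fun y => x * y)%g s) = F s.

(* A uniform [d : 'I_D] gives the trivial letter with probability
   [1 - size S / D], since [nth] is then out of range. *)
Let letter (d : 'I_D) : G := nth 1%g S d.
Let site_word (w : {ffun 'I_N -> 'I_D}) : G :=
  (\prod_(i < N) letter (w i) ^ sigma i)%g.
(** Pairs each vertex with its random displacement, as input for [prism]. The new factors stand on
    the right, so left translations are respected. *)
Let move_by (k : 'I_N) (g : G) (w : {ffun 'I_N -> 'I_D}) : G * G :=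
  (g, g * sigma k * site_word w)%g.

Definition displaced_prism (s : seq G) : R :=
  avg (fun k => seq_avg (move_by k) (prism F) s).

Let W_gt0 : (0 < #|{ffun 'I_N -> 'I_D}|)%N.
Proof. by apply/card_gt0P; exists [ffun=> Ordinal D_gt0]. Qed.

Let IN_gt0 : (0 < #|'I_N|)%N. Proof. by rewrite card_ord. Qed.

Lemma displaced_prism_invariant x s :
  displaced_prism (map (fun y => x * y)%g s) = displaced_prism s.
Proof.
apply: eq_avg => k.
rewrite (@seq_avg_map _ _ _ _ _ _ (fun p : G * G => (x * p.1, x * p.2)%g)).
  apply: eq_seq_avg => u; rewrite -(prism_map (fun y => x * y)%g).
  by apply: eq_prism => t; exact: F_invariant.
by move=> g w; rewrite /move_by /= !mulgA.
Qed.

Lemma displaced_prism_bounded s : `|displaced_prism s| <= C * (size s)%:R.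
Proof.
apply: avg_bounded => // k; apply: seq_avg_bounded => // u <-.
exact: prism_bounded.
Qed.

(** For a cocycle the second term of [prism_homotopy] vanishes, and averaging over the first
    components gives back [F s]. *)
Lemma displaced_prism_codiff s : (forall u, seq_codiff F u = 0) ->
  seq_codiff displaced_prism s =
  F s - avg (fun k => seq_avg (move_by k) (fun u => F (map snd u)) s).
Proof.
move=> F0; rewrite seq_codiffZ seq_codiff_sum.
rewrite -[F s](avg_cst IN_gt0) -avgB /avg; congr (_ * _); apply: eq_bigr => k _.
rewrite seq_codiff_avg//.
rewrite -(@seq_avg_pred _ _ W_gt0 _ _ (move_by k) fst F)// -seq_avgB//.
apply: eq_seq_avg => u; rewrite -prism_homotopy [X in _ = _ + X]prism0 ?addr0//.
Qed.

Variable m : nat.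

(* The average of [joint] is the constant that the averaged cochain approaches.
   The letters are indexed by sites first, as needed for [replace_average]. *)
Let joint (w : {ffun 'I_N -> {ffun 'I_m -> 'I_D}}) : R :=
  F [seq site_word (ffun_flip w j) | j <- enum 'I_m].

Let site_word_insert (k : 'I_N) (w : {ffun 'I_N -> 'I_D}) (d : 'I_D) :
  (size S <= w k)%N -> letter d \in S ->
  (letter d ^ sigma k * site_word w)%g = site_word (replace w k d).
Proof.
move=> wk dS; rewrite /site_word (@prod_insert _ _ _ k) //.
- apply: eq_bigr => i _; rewrite ffunE; case: eqVneq => // ->//.
- exact: index_enum_uniq.
- exact: mem_index_enum.
- by rewrite /letter nth_default// conj1g.
- move=> i ik; have [wS|wS] := ltnP (w i) (size S).
    by apply: sigma_commute; rewrite 1?eq_sym// mem_nth.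
  rewrite {2}/letter nth_default// conj1g; exact: commute1.
Qed.

(** The second error term is a union bound for the event that one of the [m] words already has a
    nontrivial letter at site [k]. Otherwise the slot is free, the entries of [s] are inserted
    there, and [replace_average] gives the first term. *)
Lemma displaced_average (e : R) (s : seq G) :
  0 < e -> (D ^ m)%:R <= N%:R * e ^+ 2 -> size s = m -> {subset s <= S} ->
  `|avg (fun k => seq_avg (move_by k) (fun u => F (map snd u)) s) - avg joint|
    <= C * e + 2 * C * m%:R * (size S)%:R / D%:R.
Proof.
move=> e0 DN sm sS.
have C0 : 0 <= C by apply: le_trans (F_bounded [::]).
pose g (j : 'I_m) := nth 1%g s j.
have sE : s = [seq g j | j <- enum 'I_m].
  apply: (@eq_from_nth _ 1%g); first by rewrite size_map size_enum_ord.
  move=> i; rewrite sm => im.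
  by rewrite (nth_map (Ordinal im)) ?size_enum_ord// /g nth_enum_ord.
have gS j : g j \in S by apply: sS; rewrite mem_nth// sm.
have gD j : (index (g j) S < D)%N by rewrite (leq_trans _ S_le)// index_mem.
(* The tuple of letters that spells out [s]. *)
pose gamma : {ffun 'I_m -> 'I_D} := [ffun j => Ordinal (gD j)].
have gammaE j : letter (gamma j) = g j by rewrite /letter ffunE/= nth_index.
have bad k : `|seq_avg (move_by k) (fun u => F (map snd u)) s
    - avg (fun w => joint (replace w k gamma))|
    <= 2 * C * m%:R * (size S)%:R / D%:R.
  rewrite [in X in `|X - _|]sE seq_avg_ffun//.
  rewrite -(avg_reindex _ (@ffun_flip_bij _ _ _)) -avgB.
  apply: le_trans (avg_norm _) _.
  apply: (@le_trans _ _ (avg (fun w : {ffun 'I_N -> {ffun 'I_m -> 'I_D}} =>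
      2 * C * \sum_(j < m) ((w k j : nat) < size S)%N%:R))).
    apply: le_avg => w.
    (* On the bad event the trivial bound [2 * C] is enough; off it the two values coincide. *)
    have [/existsP[j wj]|/existsPn good] :=
        boolP [exists j, ((w k j : nat) < size S)%N].
      apply: le_trans (ler_normB _ _) _.
      apply: (@le_trans _ _ (2 * C * 1)).
        by rewrite mulr1 mulr_natl mulr2n lerD ?F_bounded.
      apply: ler_wpM2l; first by rewrite mulr_ge0.
      rewrite (bigD1 j)//= wj lerDl sumr_ge0//.
    rewrite (_ : _ - _ = 0) ?normr0 ?mulr_ge0 ?sumr_ge0//.
    apply/eqP; rewrite subr_eq0; apply/eqP.
    (* Translating by the inverse of [sigma k] turns [g j * sigma k] into the conjugate
       [g j ^ sigma k], which is inserted at site [k]. *)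
    rewrite -(F_invariant (sigma k)^-1) -map_comp -map_comp /joint; congr F.
    apply: eq_map => j /=.
    rewrite -[in LHS]gammaE !mulgA -(mulgA _ _ (sigma k)).
    rewrite -/(conjg (letter (gamma j)) (sigma k)) site_word_insert.
    - congr site_word; apply/ffunP => i; rewrite !ffunE.
      by case: eqVneq => // _; rewrite !ffunE.
    - by rewrite !ffunE leqNgt good.
    - by rewrite gammaE.
  rewrite avgZ -!mulrA !ler_wpM2l//.
  have -> : avg (fun w : {ffun 'I_N -> {ffun 'I_m -> 'I_D}} =>
      \sum_(j < m) ((w k j : nat) < size S)%N%:R : R) =
      \sum_(j < m) avg (fun w : {ffun 'I_N -> {ffun 'I_m -> 'I_D}} =>
        ((w k j : nat) < size S)%N%:R).
    by rewrite /avg exchange_big mulr_sumr.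
  have -> : m%:R * ((size S)%:R / D%:R) =
      \sum_(j < m) ((size S)%:R / D%:R) :> R.
    by rewrite sumr_const card_ord mulr_natl.
  apply: ler_sum => j _.
  have L0 : (0 < #|{ffun 'I_m -> 'I_D}|)%N by apply/card_gt0P; exists gamma.
  rewrite (avg_marginal k (fun b : {ffun 'I_m -> 'I_D} =>
    ((b j : nat) < size S)%N%:R))//.
  rewrite (avg_marginal j (fun d : 'I_D => ((d : nat) < size S)%N%:R)) ?card_ord//.
  rewrite /avg card_ord mulrC ler_wpM2r ?invr_ge0//.
  rewrite -natr_sum ler_nat -(big_mkord xpredT (fun d => ((d < size S)%N : nat))).
  rewrite (@big_cat_nat _ _ _ (size S))//= [X in (_ + X)%N]big_nat_cond.
  rewrite [X in (_ + X)%N]big1 ?addn0 => [|i /andP[/andP[Si _] _]]; last first.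
    by rewrite ltnNge Si.
  rewrite -[leqRHS]muln1 -[X in (_ <= X * _)%N]subn0 -sum_nat_const_nat.
  by apply: leq_sum => i _; exact: leq_b1.
rewrite [leRHS]addrC.
apply: (le_trans (ler_distD
  (avg (fun k => avg (fun w => joint (replace w k gamma)))) _ _)).
apply: lerD.
  by rewrite -avgB; apply: avg_bounded.
apply: replace_average => // [w|]; first exact: F_bounded.
by rewrite card_ffun !card_ord.
Qed.

End DisplacedAverage.

Section CommutingConjugates.
Variables (R : realType) (G : groupType).
Hypothesis commuting_conjugates : forall S : seq G, exists t : G,
  forall x y, x \in S -> y \in S -> commute x (y ^ t)%g.

(** The conjugators are chosen one at a time: the hypothesis is applied to [S] together with all
    conjugates of [S] found so far. *)
Lemma commuting_conjugates_family (S : seq G) (N : nat) :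
  exists sigma : 'I_N -> G, forall i j, i != j ->
    forall x y, x \in S -> y \in S -> commute (x ^ sigma i)%g (y ^ sigma j)%g.
Proof.
suff [sigma sigmaP] : exists sigma : nat -> G, forall i j, (i < j < N)%N ->
    forall x y, x \in S -> y \in S -> commute (x ^ sigma i)%g (y ^ sigma j)%g.
  exists (fun i => sigma i) => i j ij x y xS yS.
  have [ij'|ji|/val_inj ijE] := ltngtP i j.
  - by apply: sigmaP => //; rewrite ij' ltn_ord.
  - by apply/commute_sym/sigmaP => //; rewrite ji ltn_ord.
  - by rewrite ijE eqxx in ij.
elim: N => [|N [sigma IH]]; first by exists (fun=> 1%g) => i j; rewrite andbF.
have [t tP] := commuting_conjugates
  (S ++ [seq (x ^ sigma i)%g | i <- iota 0 N, x <- S]).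
exists (fun i => if i == N then t else sigma i) => i j /andP[ij].
rewrite ltnS leq_eqVlt => /orP[/eqP jN|jN] x y xS yS.
  move: ij; rewrite jN eqxx => iN; rewrite (ltn_eqF iN).
  apply: tP; rewrite mem_cat; last by rewrite yS.
  apply/orP; right; apply/allpairsP; exists (i, x); split => //.
  by rewrite mem_iota.
rewrite (ltn_eqF jN) (ltn_eqF (ltn_trans ij jN)); apply: IH => //.
by rewrite ij.
Qed.

Variables (n : nat) (f : ('I_n.+2 -> G) -> R).
Hypothesis f_cocycle : @bounded_cocycle R G n.+1 f.

(* [f] on sequences; it vanishes on the other lengths, so that its coboundary
   vanishes on all sequences. *)
Let F (s : seq G) : R := if size s == n.+2 then f (fun i => nth 1%g s i) else 0.

Let F_codiff u : seq_codiff F u = 0.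
Proof.
have [_ df] := f_cocycle.
have sz (i : 'I_(size u)) : size (take i u ++ drop i.+1 u) = (size u).-1.
  rewrite size_cat size_take size_drop ltn_ord.
  by have := ltn_ord i; case: (size u) (i : nat) => // a b; rewrite ltnS => ba;
    rewrite subSS subnKC.
rewrite seq_codiffE; have [un|un] := eqVneq (size u) n.+3; last first.
  apply: big1 => i _; rewrite /F sz; case: ifP => [/eqP e|_]; last exact: mulr0.
  by case/eqP: un; rewrite -(ltn_predK (ltn_ord i)) e.
rewrite -[RHS](df (fun i => nth 1%g u i)) /codiff.
move: sz; rewrite un => sz; apply: eq_bigr => i _; congr (_ * _).
rewrite /F sz eqxx; congr f; apply/funext => j.
rewrite nth_cat size_take un ltn_ord /= /bump.
have [ji|ij] := ltnP j i; first by rewrite nth_take.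
by rewrite nth_drop addSn subnKC.
Qed.

Let codiff_map (b : seq G -> R) (g : 'I_n.+2 -> G) :
  codiff (fun h : 'I_n.+1 -> G => b [seq h j | j <- enum 'I_n.+1]) g =
  seq_codiff b [seq g j | j <- enum 'I_n.+2].
Proof.
rewrite seq_codiffE size_map size_enum_ord /codiff; apply: eq_bigr => i _.
congr (_ * b _); apply: (@eq_from_nth _ 1%g).
  rewrite size_cat size_take size_drop !(size_enum_ord, size_map) ltn_ord.
  by rewrite subSS subnKC// -ltnS ltn_ord.
move=> j; rewrite size_map size_enum_ord => jn.
rewrite (nth_map (Ordinal jn)) ?size_enum_ord// nth_cat size_take size_map.
rewrite size_enum_ord ltn_ord.
have jE : nth (Ordinal jn) (enum 'I_n.+1) j = Ordinal jn.
  by apply: val_inj; rewrite /= nth_enum_ord.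
rewrite jE; have [ji|ij] := ltnP j i.
  rewrite nth_take// (nth_map ord0) ?size_enum_ord ?ltnS 1?ltnW//.
  congr g; apply: val_inj; rewrite /= nth_enum_ord ?ltnS 1?ltnW//.
  by rewrite /bump leqNgt ji.
rewrite nth_drop addSn subnKC// (nth_map ord0) ?size_enum_ord//.
by congr g; apply: val_inj; rewrite /= nth_enum_ord// /bump ij.
Qed.

(** The primitive is [displaced_prism], and [K] is the mean of [F] over the undisturbed random
    words. Their bounds do not depend on [S], which allows a limit over [S]. *)
Lemma approximate_primitive (C e : R) (S : seq G) :
  (forall g, `|f g| <= C) -> 0 < e ->
  exists (b : ('I_n.+1 -> G) -> R) (K : R),
    [/\ forall g, `|b g| <= C * n.+1%:R,
        forall x g, b (fun i => x * g i)%g = b g,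
        `|K| <= C &
        forall g, (forall i, g i \in S) -> `|f g - (codiff b g + K)| <= e].
Proof.
move=> fC e0; have C0 : 0 <= C by apply: le_trans (fC (fun=> 1%g)).
have e2 : 0 < e / 2 by rewrite divr_gt0.
have C1 : 0 < C + 1 by rewrite ltr_wpDl.
(* The error [e] is split in halves: [e'] makes [C * e'] at most [e / 2], with [C + 1] guarding
   against [C = 0]; [D] makes the bad event cost at most [e / 2]; [N] provides enough sites for this
   [D] and [e']. *)
pose e' := e / 2 / (C + 1); have e'0 : 0 < e' by rewrite divr_gt0.
pose D := ((size S) + Num.truncn (2 * C * n.+2%:R * (size S)%:R / (e / 2))).+1.
pose N := (Num.truncn ((D ^ n.+2)%:R / e' ^+ 2)).+1.
have [sigma sigmaP] := commuting_conjugates_family S N.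
have FC s : `|F s| <= C by rewrite /F; case: ifP => // _; rewrite normr0.
have Finv x s : F [seq (x * y)%g | y <- s] = F s.
  rewrite /F size_map; case: ifP => // /eqP sn.
  have [[_ finv] _] := f_cocycle; rewrite -[RHS](finv x).
  by congr f; apply/funext => i; rewrite (nth_map 1%g)// sn.
have D0 : (0 < D)%N by [].
pose B := @displaced_prism R G N D S sigma F.
exists (fun g => B [seq g j | j <- enum 'I_n.+1]).
have SD : (size S <= D)%N by rewrite /D -addnS leq_addr.
have DN : (D ^ n.+2)%:R <= N%:R * e' ^+ 2.
  by rewrite -ler_pdivrMr ?exprn_gt0// ltW// truncnS_gt.
have avg_close := @displaced_average R G N D S sigma F C sigmaP isT D0 SD FC Finv
  n.+2 e' _ e'0 DN.
set K := avg _ in avg_close.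
exists K; split.
- move=> g; have := @displaced_prism_bounded R G N D S sigma F C isT D0 FC
    [seq g j | j <- enum 'I_n.+1].
  by rewrite size_map size_enum_ord.
- move=> x g.
  rewrite -[RHS](@displaced_prism_invariant R G N D S sigma F Finv x).
  exact: (congr1 B (map_comp (fun y => x * y)%g g _)).
- by apply: avg_bounded => //; apply/card_gt0P; exists [ffun=> [ffun=> Ordinal D0]].
- move=> g gS; rewrite codiff_map displaced_prism_codiff//.
  set s := map _ _; have sn : size s = n.+2 by rewrite size_map size_enum_ord.
  have -> : f g = F s.
    rewrite /F sn eqxx; congr f; apply/funext => i.
    by rewrite (nth_map ord0) ?size_enum_ord// nth_ord_enum.
  have sS : {subset s <= S} by move=> x /mapP[j _ ->].
  have := avg_close s sn sS; set T := avg (fun k => _) => TK.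
  have -> : F s - (F s - T + K) = T - K by ring.
  apply: le_trans TK _; rewrite [leRHS](splitr e); apply: lerD.
    by rewrite /e' mulrA ler_pdivrMr// [leLHS]mulrC ler_wpM2l ?lerDl ?(ltW e2).
  rewrite ler_pdivrMr ?ltr0n// -ler_pdivrMl// mulrC.
  apply/ltW/(lt_le_trans (truncnS_gt _)); rewrite ler_nat ltnS.
  exact: leq_addl.
Qed.

End CommutingConjugates.

(** Compactness of the interval gives a cluster point, and an ultrafilter converges to each of its
    cluster points. *)
Lemma bounded_ultra_cvg (R : realType) (T : Type) (U : set_system T)
    (f : T -> R) (C : R) :
  UltraFilter U -> (forall t, `|f t| <= C) ->
  exists l : R, `|l| <= C /\ f @ U --> l.
Proof.
move=> UU fC; have FC : (f @ U) [set` `[- C, C]].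
  by apply: (@filterE _ U) => t; rewrite /= in_itv /= -ler_norml.
have [l [lC cl]] := @segment_compact R (- C) C (f @ U) _ FC.
exists l; split; first by move: lC; rewrite /= in_itv /= -ler_norml.
move=> N lN; have [//|UN] := @in_ultra_setVsetC _ _ (f @^-1` N) UU.
by have [x []] := cl (~` N) N UN lN.
Qed.

(** An ultrafilter limit of the approximate primitives gives [f = codiff b' + K'] exactly; the
    parity of the degree disposes of the constant. *)
Lemma commuting_conjugates_boundedly_acyclic (R : realType) (G : groupType) :
  (forall S : seq G, exists t : G,
     forall x y, x \in S -> y \in S -> commute x (y ^ t)%g) ->
  boundedly_acyclic R G.
Proof.
move=> hG n f fP; have [[[C fC] finv] df] := fP.
have C0 : 0 <= C by apply: le_trans (fC (fun=> 1%g)).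
have e0 (S : seq G) : 0 < (size S).+1%:R^-1 :> R by rewrite invr_gt0.
have /choice[b /choice[K bK]] := fun S => approximate_primitive hG fP S fC (e0 S).
(* Demanding length as well as containment makes the errors [1 / (size S + 1)] tend to 0, also when
   [G] is finite. *)
pose base (T : seq G) := [set S : seq G | (size T <= size S)%N /\ {subset T <= S}].
have FF : ProperFilter (filter_from setT base).
  apply: filter_from_proper => [|T _]; last by exists T; split.
  apply: filter_fromT_filter; first by exists [::].
  move=> T T'; exists (T ++ T') => S [].
  rewrite size_cat => sS TS; split; split.
  - exact: leq_trans (leq_addr _ _) sS.
  - by move=> x xT; apply: TS; rewrite mem_cat xT.
  - exact: leq_trans (leq_addl _ _) sS.
  - by move=> x xT; apply: TS; rewrite mem_cat xT orbT.
have [U [UU FU]] := ultraFilterLemma FF.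
have /choice[b' b'P] : forall g, exists l : R,
    `|l| <= C * n.+1%:R /\ (fun S => b S g) @ U --> l.
  by move=> g; apply: bounded_ultra_cvg => S; have [bS _ _ _] := bK S; exact: bS.
have [K' [_ K'P]] : exists K' : R, `|K'| <= C /\ K @ U --> K'.
  by apply: bounded_ultra_cvg => S; have [_ _ KS _] := bK S; exact: KS.
have b'b : @bounded_cochain R G n b'.
  split=> [|x g]; first by exists (C * n.+1%:R) => g; have [] := b'P g.
  have [_ b1] := b'P (fun i => x * g i)%g; have [_ b2] := b'P g.
  have E : (fun S => b S (fun i => x * g i)%g) = (fun S => b S g).
    by apply/funext => S; have [_ bS _ _] := bK S; exact: bS.
  by rewrite E in b1; exact: (cvg_unique _ b1 b2).
have fE g : f g = codiff b' g + K'.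
  have lim1 : (fun S => codiff (b S) g + K S) @ U --> codiff b' g + K'.
    apply: cvgD => //; apply: cvg_big => [|i _]; first exact: add_continuous.
    apply: cvgM; first exact: cvg_cst.
    by have [] := b'P (fun j => g (lift i j)).
  suff lim2 : (fun S => codiff (b S) g + K S) @ U --> f g.
    by apply: (cvg_unique _ lim2 lim1).
  apply/cvgrPdist_le => e e0'; apply: FU.
  (* The padding by [1] forces [size S + 1] above [1 / e]. *)
  exists (nseq (Num.truncn e^-1) 1%g ++ [seq g j | j <- enum 'I_n.+2]) => //.
  move=> S [sS TS] /=; have [_ _ _ /(_ g) gS] := bK S.
  apply: le_trans (gS _) _.
    by move=> i; apply: TS; rewrite mem_cat map_f ?orbT// mem_enum.
  rewrite invf_ple ?posrE ?e0'// ltW// (lt_le_trans (truncnS_gt _))//.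
  rewrite ler_nat ltnS (leq_trans _ sS)// size_cat size_nseq; exact: leq_addr.
have alt N : \sum_(i < N.+1) (-1) ^+ i = (~~ odd N)%:R :> R.
  elim: N => [|N ih]; first by rewrite big_ord_recr big_ord0 /= add0r expr0.
  rewrite big_ord_recr /= ih -signr_odd /=.
  by case: (odd N); rewrite /= ?expr0 ?expr1 ?add0r ?addr0 ?subrr.
have codiff_cst N c (h : 'I_N.+2 -> G) : codiff (fun=> c) h = (odd N)%:R * c :> R.
  by rewrite /codiff -mulr_suml alt /= negbK.
have codiff1 N (h : ('I_N.+1 -> G) -> R) :
    codiff h (fun=> 1%g) = (odd N)%:R * h (fun=> 1%g).
  by rewrite -(codiff_cst N (h (fun=> 1%g)) (fun=> 1%g)).
(* For odd [n] the constant [K'] is the coboundary of a constant. For even [n] it is 0: at the tuple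
   with all entries [1], the cocycle condition gives [f = 0] and the coboundary of [b'] vanishes. *)
have [n_odd|n_even] := boolP (odd n).
  exists (fun g => b' g + K').
    have [[C' b'C] b'inv] := b'b; split=> [|x g]; last by rewrite b'inv.
    exists (C' + `|K'|) => g; apply: le_trans (ler_normD _ _) _.
    by rewrite lerD2r.
  apply/funext => g; rewrite fE.
  have -> : codiff b' g + K' = codiff b' g + codiff (fun=> K') g.
    by rewrite codiff_cst n_odd mul1r.
  by rewrite /codiff -big_split; apply: eq_bigr => i _; rewrite mulrDr.
have K0 : K' = 0.
  have := df (fun=> 1%g); rewrite codiff1 /= n_even mul1r fE codiff1.
  by rewrite (negbTE n_even) mul0r add0r.
by exists b' => //; apply/funext => g; rewrite fE K0 addr0.
Qed.

(** * Pushing along a vector *)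

Section EpsilonDifferential.
Variables (R : realType) (V W : normedModType R).

Lemma diff_epsilon (f : V -> W) (x : V) : differentiable f x ->
  forall e, 0 < e -> \forall h \near (0 : V),
    `|f (h + x) - f x - 'd f x h| <= e * `|h|.
Proof.
move=> /diff_locallyP[_ /eqaddoP dfE] e e0; have := dfE e e0.
by apply: filterS => h /=; rewrite !fctE /= opprD addrA.
Qed.

Lemma epsilon_diff (f : V -> W) (df : {linear V -> W}) (x : V) :
  continuous df ->
  (forall e, 0 < e -> \forall h \near (0 : V),
     `|f (h + x) - f x - df h| <= e * `|h|) ->
  differentiable f x /\ 'd f x = df :> (V -> W).
Proof.
move=> cdf fE; have E : f \o shift x = cst (f x) + df +o_ 0 id.
  apply/eqaddoP => e e0; have := fE e e0.
  by apply: filterS => h /=; rewrite !fctE /= opprD addrA.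
have dE := diff_unique cdf E.
by split=> //; apply/diff_locallyP; rewrite dE.
Qed.

End EpsilonDifferential.

(** * The flat function exp(-1/x) and its derivatives *)

Section Flat.
Variable R : realType.
Implicit Types (x : R) (n : nat).

(* The family is closed under derivation up to linear combinations. *)
Definition flat n x : R := if 0 < x then x^-1 ^+ n * expR (- x^-1) else 0.

Lemma flat_ge0 n x : 0 <= flat n x.
Proof.
rewrite /flat; case: ifP => // x0.
by rewrite mulr_ge0 ?expR_ge0// exprn_ge0// invr_ge0 ltW.
Qed.

(** The term of order [n.+1] of the exponential series bounds [expR x^-1] from below. *)
Lemma flat_bound n x : flat n x <= n.+1`!%:R * `|x|.
Proof.
rewrite /flat; case: ifP => [x0|_]; last by rewrite mulr_ge0.
have y0 : 0 < x^-1 by rewrite invr_gt0.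
have := expR_ge1Dxn n (ltW y0).
rewrite expRN gtr0_norm// ler_pdivrMr ?expR_gt0// => E.
have F0 : 0 < n.+1`!%:R :> R by rewrite ltr0n fact_gt0.
have E' : x^-1 ^+ n * x^-1 <= n.+1`!%:R * expR x^-1.
  by rewrite -exprSr mulrC -ler_pdivrMr//; lra.
have -> : x^-1 ^+ n = x^-1 ^+ n * x^-1 * x by rewrite mulfVK// lt0r_neq0.
by rewrite [leRHS]mulrAC ler_wpM2r// ltW.
Qed.

Lemma flat_step n x : flat n x = x * flat n.+1 x.
Proof.
rewrite /flat; case: ifP => [x0|_]; last by rewrite mulr0.
by rewrite exprS !mulrA divff ?mul1r// lt0r_neq0.
Qed.

Lemma is_derive_flat n x :
  is_derive x 1 (flat n) (flat n.+2 x - n%:R * flat n.+1 x).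
Proof.
have [x0|x0|<-] := ltgtP 0 x.
- have xn0 : x != 0 by rewrite lt0r_neq0.
  have dV : is_derive x 1 (fun y : R => y^-1) (- x ^- 2).
    apply: DeriveDef; first exact: derivableV.
    by rewrite deriveV// derive_id /= -[RHS]mulr1.
  apply: (@near_eq_is_derive _ _ _
    ((fun y : R => y^-1) ^+ n * (expR \o (- (fun y : R => y^-1))))).
    near=> y; rewrite /flat ifT; last by near: y; exact: lt_nbhsr.
    by rewrite !fctE.
  have dE : is_derive x 1 (expR \o (- (fun y : R => y^-1)))
      (expR (- x^-1) * x ^- 2).
    have d1 : derivable (- (fun y : R => y^-1)) x 1 by [].
    have d2 : derivable (@expR R) (- x^-1) 1 by [].
    apply: DeriveDef.
      by apply/derivable1_diffP/differentiable_comp; exact/derivable1_diffP.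
    by rewrite -derive1E derive1_comp// !derive1E !derive_val opprK.
  apply: (is_derive_eq (is_deriveM (is_deriveX n dV) dE)).
  rewrite /flat x0 !fctE /= /GRing.scale /=.
  case: n => [|n]; first by rewrite !expr0; field.
  by rewrite !exprS /=; field.
- apply: (@near_eq_is_derive _ _ _ (cst 0)).
    near=> y; rewrite /flat ifF//; apply/negbTE; rewrite -leNgt ltW//.
    by near: y; exact: lt_nbhsl.
  by rewrite /flat ltNge ltW//= mulr0 subr0; exact: is_derive_cst.
(* At 0 the increment is [h * flat n.+1 h], and [flat_bound] makes the second factor small. *)
- have f0 k : flat k 0 = 0 by rewrite /flat ltxx.
  rewrite !f0 mulr0 subr0.
  have [] := @epsilon_diff R R R (flat n) (\0%R : {linear R -> R}) 0.
  + exact: cst_continuous.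
  + move=> e e0; near=> h; rewrite addr0 f0 !subr0 ger0_norm ?flat_ge0//.
    rewrite flat_step mulrC; apply: le_trans (_ : flat n.+1 h * `|h| <= _).
      by rewrite ler_wpM2l ?flat_ge0// ler_norm.
    rewrite ler_wpM2r//; apply: le_trans (flat_bound _ _) _.
    rewrite mulrC -ler_pdivlMr ?ltr0n ?fact_gt0//; near: h; apply: (@nbhs0_le R R^o).
    by rewrite divr_gt0// ltr0n fact_gt0.
  + move=> df dE; apply: DeriveDef; first exact/derivable1_diffP.
    by rewrite deriveE// dE.
Unshelve. all: by end_near. Qed.

Lemma differentiable_flat n x : differentiable (flat n) x.
Proof. by apply/derivable1_diffP; have [] := is_derive_flat n x. Qed.

Lemma diff_flat n x h :
  'd (flat n) x h = h * (flat n.+2 x - n%:R * flat n.+1 x).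
Proof.
rewrite diff1E; last exact: differentiable_flat.
by rewrite derive1E; have [_ ->] := is_derive_flat n x.
Qed.

Lemma flat_le1 x : flat 0 x <= 1.
Proof.
rewrite /flat; case: ifP => // x0; rewrite expr0 mul1r.
by rewrite expR_le1 oppr_le0 invr_ge0 ltW.
Qed.

Lemma flat_gt0 n x : 0 < x -> 0 < flat n x.
Proof.
by move=> x0; rewrite /flat x0 mulr_gt0 ?expR_gt0// exprn_gt0// invr_gt0.
Qed.

Lemma flat_nondecreasing : {homo flat 0 : x y / x <= y}.
Proof.
move=> x y xy; rewrite /flat; case: ifP => [x0|_]; last exact: flat_ge0.
have y0 := lt_le_trans x0 xy; rewrite y0 !expr0 !mul1r ler_expR lerN2.
by rewrite lef_pV2 ?posrE.
Qed.

(** Mean value theorem: for [x > 0] the derivative is [y ^ 2 * expR (- y)] with [y = 1 / x], and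
    [expR y >= 1 + y ^ 2 / 2] bounds it by 2. *)
Lemma flat_lipschitz x y : `|flat 0 x - flat 0 y| <= 2 * `|x - y|.
Proof.
wlog xy : x y / x <= y.
  move=> H; have [xy|/ltW yx] := leP x y; first exact: H.
  by rewrite distrC [`|x - y|]distrC H.
have [z _ ] := MVT_segment xy (fun z _ => is_derive_flat 0 z)
  (continuous_subspaceT (fun z => differentiable_continuous (differentiable_flat 0 z))).
rewrite mul0r subr0 distrC => ->; rewrite [`|x - y|]distrC normrM.
rewrite ler_wpM2r// ger0_norm ?flat_ge0//.
rewrite /flat; case: ifP => // z0; rewrite expRN ler_pdivrMr ?expR_gt0//.
have z0' : 0 < z^-1 by rewrite invr_gt0.
have := expR_ge1Dxn 1 (ltW z0'); rewrite (_ : 2`! = 2)%N//; lra.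
Qed.

End Flat.

Section CkFunctions.
Variables (R : realType) (m : nat).
Implicit Types (U : set 'rV[R]_m) (g : 'rV[R]_m -> R).

(** Induction on [k] for all [n] at once, since differentiation raises [n]. *)
Lemma Ck_flat n k U g : open U -> Ck k U g -> Ck k U (fun x => flat n (g x)).
Proof.
move=> oU; elim: k n => [|k ih] n.
  move=> cg x Ux; apply: (@continuous_comp _ _ _ g (flat n)); first exact: cg.
  exact: differentiable_continuous (differentiable_flat n _).
move=> Hg; have cg := Ck_S Hg; case: Hg => dg Dg; split=> [x Ux|v].
  apply: (@differentiable_comp _ _ _ _ g (flat n)); first exact: dg.
  exact: differentiable_flat.
apply: (@Ck_ext _ _ _ _ _ (fun x => 'd g x v *
    (flat n.+2 (g x) + (- n%:R) * flat n.+1 (g x)))) => //.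
  move=> x Ux; rewrite (@diff_comp _ _ _ _ g (flat n))/= ?diff_flat ?mulNr//.
    exact: dg.
  exact: differentiable_flat.
apply: Ck_mul => //; first exact: Dg.
apply: Ck_add => //; first exact: ih.
by apply: Ck_mul => //; [exact: Ck_cst | exact: ih].
Qed.

Lemma Ck_inv k U g : open U -> (forall x, U x -> g x != 0) ->
  Ck k U g -> Ck k U (fun x => (g x)^-1).
Proof.
move=> oU g0; elim: k => [|k ih].
  by move=> cg x Ux; exact: (cvgV (g0 x Ux) (cg x Ux)).
move=> Hg; have cg := Ck_S Hg; case: Hg => dg Dg; split=> [x Ux|v].
  by apply: differentiableV; [exact: dg | exact: g0].
apply: (@Ck_ext _ _ _ _ _ (fun x => - 1 * ((g x)^-1 * (g x)^-1) * 'd g x v)) => //.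
  move=> x Ux; rewrite diffV ?g0//=; last exact: dg.
  by rewrite /GRing.scale /= mulN1r expr2 invfM.
apply: Ck_mul => //; last exact: Dg.
apply: Ck_mul => //; first exact: Ck_cst.
by apply: Ck_mul => //; exact: ih.
Qed.

Lemma Ck_prod n k U (f : 'I_n -> 'rV[R]_m -> R) :
  open U -> (forall i, Ck k U (f i)) -> Ck k U (fun x => \prod_i f i x).
Proof.
move=> oU; elim: n f => [|n ih] f Hf.
  apply: (@Ck_ext _ _ R^o _ _ (fun=> 1 : R)) => //; last exact: Ck_cst.
  by move=> x _; rewrite big_ord0.
apply: (@Ck_ext _ _ _ _ _ (fun x => f ord0 x * \prod_i f (lift ord0 i) x)) => //.
  by move=> x _; rewrite big_ord_recl.
by apply: Ck_mul => //; exact: ih.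
Qed.

End CkFunctions.

(** * The push along a vector and its inverse *)

Section Push.
Variables (R : realType) (V : normedModType R).
Variables (rho : V -> R) (e : V).
Hypothesis rho_diff : forall p, differentiable rho p.
Hypothesis rho_itv : forall v, 0 <= rho v <= 1.
Hypothesis rho_contract :
  forall v s, `|rho (v + s *: e) - rho v| <= 2^-1 * `|s|.

Definition push (v : V) : V := v + rho v *: e.

Let rho_cont v : {for v, continuous rho}.
Proof. exact: differentiable_continuous (rho_diff v). Qed.

(** Intermediate value theorem on [[0, 1]], with signs at the ends given by [0 <= rho <= 1]. *)
Lemma pull_exists (y : V) : exists s, s = rho (y - s *: e).
Proof.
have /(IVT ler01) : {within `[0, 1], continuous (fun s => s - rho (y - s *: e))}.
  apply: continuous_subspaceT => s; apply: cvgB; first exact: cvg_id.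
  have c1 : {for s, continuous (fun s : R => y - s *: e)}.
    by apply: cvgB; [exact: cvg_cst|exact: scalel_continuous].
  exact: (continuous_comp c1 (@rho_cont _)).
move=> /(_ 0) []; last first.
  by move=> s _ /eqP; rewrite subr_eq0 => /eqP; exists s.
have /andP[r0 _] := rho_itv (y - 0 *: e).
have /andP[_ r1] := rho_itv (y - 1 *: e).
by rewrite ge_min le_max sub0r oppr_le0 r0 subr_ge0 r1 orbT.
Qed.

Definition pull_time (y : V) : R := xget 0 [set s | s = rho (y - s *: e)].

Definition pull (y : V) : V := y - pull_time y *: e.

Lemma pull_timeE y : pull_time y = rho (pull y).
Proof.
exact: (@xgetPex _ 0 [set s | s = rho (y - s *: e)] (pull_exists y)).
Qed.

(** The a posteriori estimate for the fixed point of a contraction of ratio 1/2. It yields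
    uniqueness, continuity and a Lipschitz bound for [pull_time]. *)
Lemma pull_time_dist y s :
  `|pull_time y - s| <= 2 * `|rho (y - s *: e) - s|.
Proof.
have := rho_contract (y - s *: e) (s - pull_time y).
have -> : y - s *: e + (s - pull_time y) *: e = pull y.
  by rewrite scalerBl addrA subrK.
rewrite -pull_timeE [`|s - _|]distrC => H.
have := ler_distD (rho (y - s *: e)) (pull_time y) s; lra.
Qed.

Lemma pushK : cancel push pull.
Proof.
move=> v; suff E : pull_time (push v) = rho v by rewrite /pull E addrK.
apply/eqP; rewrite -subr_eq0 -normr_le0.
by apply: le_trans (pull_time_dist _ _) _; rewrite addrK subrr normr0 mulr0.
Qed.

Lemma pullK : cancel pull push.
Proof. by move=> y; rewrite /push -pull_timeE subrK. Qed.

Lemma pull_time_continuous (y : V) : pull_time @ y --> pull_time y.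
Proof.
apply/(@cvgrPdist_le _ _ _ (nbhs y)) => a a0.
have rc : (fun z : V => rho (z - pull_time y *: e)) @ y -->
    rho (y - pull_time y *: e).
  have c1 : {for y, continuous (fun z : V => z - pull_time y *: e)}.
    apply: (@cvgB _ _ _ (nbhs y) _ id (fun=> pull_time y *: e)).
      exact: cvg_id.
    exact: cvg_cst.
  exact: (continuous_comp c1 (@rho_cont _)).
have a2 : 0 < a / 2 by rewrite divr_gt0.
move: rc => /cvgrPdist_le/(_ _ a2); apply: filterS => z /=.
rewrite -/(pull y) -pull_timeE => H.
rewrite distrC; apply: le_trans (pull_time_dist _ _) _.
by rewrite distrC mulrC -ler_pdivlMr.
Qed.

Definition push_slope p : R := 1 + 'd rho p e.

(** Contraction allows [rho] a slope of 1/2 along [e]; the remainder of the linearisation costs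
    another 1/4, which leaves 1/4. *)
Let push_slope_gt p : 4^-1 <= push_slope p.
Proof.
have e1 : 0 < `|e| + 1 by rewrite ltr_wpDl.
have c0 : 0 < 4^-1 / (`|e| + 1) by rewrite divr_gt0.
have [d /= d0 dP] := (nbhs_norm0P.1 (diff_epsilon (rho_diff p) c0)).
pose s := d / 2 / (`|e| + 1); have s0 : 0 < s by rewrite !divr_gt0.
have se : `|s *: e| < d.
  rewrite normrZ gtr0_norm// /s mulrAC ltr_pdivrMr//.
  apply: (@le_lt_trans _ _ (d / 2 * (`|e| + 1))); last by rewrite ltr_pM2r//; lra.
  by rewrite ler_pM2l ?lerDl// divr_gt0.
have /= := dP _ se; rewrite linearZ /= normrZ => H.
have := rho_contract p s; rewrite [p + _]addrC => H'.
have : `|s *: 'd rho p e| <= 4^-1 * `|s| + 2^-1 * `|s|.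
  apply: le_trans (_ : `|rho (s *: e + p) - rho p - s *: 'd rho p e| +
    `|rho (s *: e + p) - rho p| <= _).
    by rewrite -{1}[s *: _](subKr (rho (s *: e + p) - rho p)) [leRHS]addrC ler_normB.
  apply: lerD => //; apply: le_trans H _.
  rewrite mulrAC ler_pdivrMr// -[leRHS]mulrA !ler_wpM2l//.
  by rewrite lerDl.
rewrite normrZ gtr0_norm// => H2.
have : `|'d rho p e| <= 3 / 4.
  by rewrite -(ler_pM2l s0); apply: le_trans H2 _; lra.
by rewrite ler_norml /push_slope; lra.
Qed.

Lemma push_slope_gt0 p : 0 < push_slope p.
Proof. by apply: lt_le_trans (push_slope_gt p). Qed.

(* Implicit differentiation of [s = rho (y - s *: e)]. *)
Lemma pull_time_diff y : differentiable pull_time y /\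
  'd pull_time y = (fun h => 'd rho (pull y) h / push_slope (pull y)) :> (V -> R).
Proof.
set p := pull y; pose L : {linear V -> R} := (push_slope p)^-1 \*: 'd rho p.
have LE h : L h = 'd rho p h / push_slope p by rewrite mulrC.
have [||df dE] := @epsilon_diff R V R pull_time L y; last first.
- by split=> //; rewrite dE; apply/funext => h; exact: LE.
- move=> a a0.
  have [M M0 ML] := linear_lipschitz (diff_continuous (rho_diff p)).
  (* [Q] bounds the growth of [pull] near [y]; the tolerance [a / 4 / Q] allows for this and for a
     slope as small as 1/4. *)
  pose Q := 1 + 2 * (M + 1) * `|e|.
  have Q0 : 0 < Q by rewrite ltr_wpDr// !mulr_ge0// addr_ge0// ltW.
  have aQ0 : 0 < a / 4 / Q by rewrite !divr_gt0.
  have [d /= d0 dP] := (nbhs_norm0P.1 (diff_epsilon (rho_diff p) aQ0)).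
  have := diff_epsilon (rho_diff p) ltr01.
  have : \forall h \near (0 : V), `|h| < d / Q.
    by apply: nbhs0_lt; rewrite divr_gt0.
  apply: filterS2 => h hd h1.
  set D := pull_time (h + y) - pull_time y.
  have Dh : `|D| <= 2 * (M + 1) * `|h|.
    apply: le_trans (pull_time_dist _ _) _; rewrite -mulrA ler_wpM2l//.
    rewrite -addrA -/(pull y) -/p [X in _ - X]pull_timeE -/p.
    rewrite -{1}[rho _ - _](subrK ('d rho p h)); apply: le_trans (ler_normD _ _) _.
    by rewrite [leLHS]addrC mulrDl; apply: lerD.
  (* The increment of [pull]. Linearising [rho] along it gives an equation for [D], which [DE]
     solves up to the remainder. *)
  pose k := h - D *: e.
  have kE : pull (h + y) = k + p.
    rewrite /k /p /pull /D scalerBl opprB addrACA.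
    by rewrite [_ *: e - _ - _]addrAC subrr add0r.
  have kh : `|k| <= Q * `|h|.
    apply: le_trans (ler_normB _ _) _; rewrite normrZ mulrDl mul1r lerD2l.
    by rewrite mulrAC ler_wpM2r.
  have kd : `|k| < d by apply: le_lt_trans kh _; rewrite mulrC -ltr_pdivlMr.
  have := dP _ kd; rewrite -kE -pull_timeE -[rho p]pull_timeE -/D => H.
  have DE : D - L h = (D - 'd rho p k) / push_slope p.
    have dk : 'd rho p k = 'd rho p h - D * 'd rho p e by rewrite linearB linearZ.
    rewrite LE dk /push_slope; field.
    exact: lt0r_neq0 (push_slope_gt0 p).
  rewrite -/D DE normrM [`|_^-1|]gtr0_norm ?invr_gt0 ?push_slope_gt0//.
  rewrite ler_pdivrMr ?push_slope_gt0//.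
  apply: le_trans H _; apply: (@le_trans _ _ (a / 4 / Q * (Q * `|h|))).
    by rewrite ler_wpM2l// ltW.
  rewrite mulrA divfK ?lt0r_neq0// mulrAC -[leRHS]mulrA -mulrA.
  by rewrite ler_wpM2l ?(ltW a0)// ler_wpM2l// push_slope_gt.
- move=> h; rewrite /L; apply: cvgZ; first exact: cvg_cst.
  exact: diff_continuous.
Qed.

End Push.

Section CkPush.
Variables (R : realType) (m : nat).
Variables (rho : 'rV[R]_m -> R) (e : 'rV[R]_m).
Hypothesis rho_Ck : forall k, Ck k setT rho.
Hypothesis rho_itv : forall v, 0 <= rho v <= 1.
Hypothesis rho_contract :
  forall v s, `|rho (v + s *: e) - rho v| <= 2^-1 * `|s|.

Let rho_diff p : differentiable rho p.
Proof. by case: (rho_Ck 1) => + _; exact. Qed.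

Let oT : open [set: 'rV[R]_m]. Proof. exact: openT. Qed.

Lemma Ck_push k : Ck k setT (push rho e).
Proof. exact: (Ck_add oT (Ck_id _ _) (Ck_scalel _ oT (rho_Ck k))). Qed.

Let Ck_pull_of_time k :
  Ck k setT (pull_time rho e) -> Ck k setT (pull rho e).
Proof.
move=> Ht.
apply: (@Ck_ext _ _ _ _ _ (fun y => y + (- 1 * pull_time rho e y) *: e) _ oT).
  by move=> y _; rewrite mulN1r scaleNr.
apply: (Ck_add oT (Ck_id _ _)); apply: (Ck_scalel _ oT).
exact: (Ck_mul oT (Ck_cst _ _ _)).
Qed.

(** Bootstrapping: by [pull_time_diff] the derivative is built from that of [rho] composed with
    [pull], and [pull] is already of class [k] by induction. *)
Lemma Ck_pull_time k : Ck k setT (pull_time rho e).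
Proof.
have time_diff := pull_time_diff rho_diff rho_itv rho_contract.
elim: k => [|k ih].
  by move=> y _; exact: (pull_time_continuous rho_diff rho_itv rho_contract).
split=> [y _|v]; first by have [] := time_diff y.
have dC w : Ck k setT (fun y => 'd rho (pull rho e y) w).
  have [_ /(_ w) dw] := rho_Ck k.+1.
  exact: (@Ck_comp1 _ _ _ _ _ setT (pull rho e) (fun y => 'd rho y w) oT
    (fun _ _ => I) (Ck_pull_of_time ih) dw).
have sC : Ck k setT (fun y => (push_slope rho e (pull rho e y))^-1).
  apply: (@Ck_inv R m k setT (fun y => push_slope rho e (pull rho e y)) oT) => [y _|].
    exact: lt0r_neq0 (push_slope_gt0 rho_diff rho_contract _).
  exact: (Ck_add oT (Ck_cst _ _ _) (dC e)).
refine (@Ck_ext R m R k setT _ _ oT _ (Ck_mul oT (dC v) sC)) => y _.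
have [_ E] := time_diff y; exact: (esym (congr1 (fun f => f v) E)).
Qed.

Lemma Ck_pull k : Ck k setT (pull rho e).
Proof. exact: Ck_pull_of_time (Ck_pull_time k). Qed.

End CkPush.

(** * Displacement *)

Lemma disjoint_commute (T : Type) (A B : set T) (a b : selfbij T) :
  (forall x, a x <> x -> A x) -> (forall x, b x <> x -> B x) ->
  A `&` B `<=` set0 -> commute a b.
Proof.
move=> aA bB AB; apply: selfbij_eq => x /=.
have fixA y : ~ A y -> a y = y by move=> nA; apply: contrapT => /aA.
have fixB y : ~ B y -> b y = y by move=> nB; apply: contrapT => /bB.
have [ax|ax] := pselect (a x = x).
  rewrite ax; have [->|bx] := pselect (b x = x); first by [].
  have Bbx : B (b x).
    apply: contrapT => /fixB bbx; apply: bx.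
    exact: (can_inj (selfbijK b)).
  by apply: fixA => Abx; exact: (AB (b x)).
have Ax := aA _ ax; rewrite (fixB x) => [|Bx]; last exact: (AB x).
rewrite fixB// => Bax; apply: (AB (a x)); split=> //.
by apply: contrapT => /fixA aax; apply: ax; exact: (can_inj (selfbijK a)).
Qed.

(** All elements of a finite [S] are supported in one compact [K]. Their conjugates by [t] move only
    points of the preimage of [K] under [t], which misses [K]. *)
Lemma displaceable_boundedly_acyclic (R : realType) (Z : topologicalType)
    (H : subgroup (selfbij Z)) :
  (forall f, subgroup_set H f -> compact (Defs.support f)) ->
  (forall K : set Z, compact K ->
     exists2 t, subgroup_set H t & forall x, K x -> ~ K (t x)) ->
  boundedly_acyclic R H.
Proof.
move=> Hc Hd; apply: commuting_conjugates_boundedly_acyclic => S.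
have [K cK SK] : exists2 K : set Z, compact K &
    forall s : H, s \in S -> forall x, val s x <> x -> K x.
  elim: S => [|s S [K cK SK]]; first by exists set0 => //; exact: compact0.
  exists (Defs.support (val s) `|` K).
    by apply: compactU => //; apply: Hc; have := valP s; rewrite inE.
  move=> u; rewrite inE => /orP[/eqP -> x sx|uS x ux].
    by left; exact: subset_closure.
  by right; exact: SK ux.
have [t Ht tK] := Hd K cK.
have tH : t \in mem (subgroup_set H) by rewrite inE.
exists (Sub t tH : H) => x y xS yS; apply: val_inj.
apply: (@disjoint_commute _ K [set z | K (t z)] (val x)
  (t^-1 * (val y * t))%g).
- by move=> z; exact: SK.
- move=> z /= yz; apply: (SK y yS) => yt; apply: yz.
  by rewrite yt; exact: selfbijK.
- by move=> z [Kz]; exact: tK.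
Qed.

(** * Inclusions among the four groups *)

Section Inclusions.
Variables (R : realType) (r : option nat) (m : nat) (Z : manifold R r m).

Lemma Diff_c_Homeo_c : Diff_c_set (Z := Z) `<=` Homeo_c_set (Z := Z).
Proof. by move=> f [[? _] [? _] ?]; split. Qed.

Lemma Diff_c0_Diff_c : Diff_c0_set (Z := Z) `<=` Diff_c_set (Z := Z).
Proof.
move=> f [H [F [K [_ _ HP _ <-]]]].
by have [] := HP 1; first by rewrite in_itv /= ler01 lexx.
Qed.

Lemma Diff_c0_Homeo_c0 : Diff_c0_set (Z := Z) `<=` Homeo_c0_set R (Z := Z).
Proof.
move=> f [H [F [K [cK [cF _] HP H0 H1]]]]; exists H, K; split => //; last first.
  by move=> t /HP[/Diff_c_Homeo_c ? ? _].
apply/subspace_continuousP => -[x t] /= [_ t01].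
have c0 : {for (x, t), continuous (fun p : Z * R => const_mx p.2 : 'rV[R]_1)}.
  apply: rV_continuous => j.
  rewrite (_ : (fun y => _) = snd); first exact: cvg_snd.
  by apply/funext => y; rewrite mxE.
have c1 : {for (x, t), continuous (fun p : Z * R => (p.1, const_mx p.2 : 'rV[R]_1))}.
  exact: (cvg_pair cvg_fst c0).
have c2 : (fun p : Z * R => F (p.1, const_mx p.2)) @ nbhs (x, t) -->
    F (x, const_mx t).
  exact: (continuous_comp c1 (cF (x, const_mx t))).
have [_ _ HE] := HP t t01.
move=> A HA; have {HA} : nbhs (H t x) A := HA; rewrite HE => /c2 FA.
have {}FA : \forall p \near ((x, t) : Z * R), A (F (p.1, const_mx p.2)) := FA.
suff : \forall p \near ((x, t) : Z * R),
  ([set: Z] `*` `[0, 1]) p -> A (H p.2 p.1) by [].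
by apply: filterS FA => -[y s] /= Ays [_ s01]; have [_ _ ->] := HP s s01.
Qed.

End Inclusions.

(** * A bump function on a box *)

Section Bump.
Variables (R : realType) (n : nat) (B : R).

Definition bump_factor (x : R) : R := flat 0 (B - x) * flat 0 (B + x).

(** The factor [8^-1] turns the Lipschitz constant 4 of [bump_factor] into the contraction ratio 1/2
    that pushing requires. *)
Definition box_bump (v : 'rV[R]_n.+1) : R := 8^-1 * \prod_j bump_factor (v 0 j).

Let e0 : 'rV[R]_n.+1 := delta_mx 0 0.

Lemma bump_factor_itv x : 0 <= bump_factor x <= 1.
Proof. by rewrite mulr_ge0 ?flat_ge0//= mulr_ile1 ?flat_ge0 ?flat_le1. Qed.

Lemma bump_factor_lipschitz x y : `|bump_factor x - bump_factor y| <= 4 * `|x - y|.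
Proof.
have -> : bump_factor x - bump_factor y =
    (flat 0 (B - x) - flat 0 (B - y)) * flat 0 (B + x) +
    flat 0 (B - y) * (flat 0 (B + x) - flat 0 (B + y)).
  by rewrite /bump_factor; ring.
have flat_norm z : `|flat 0 z : R| <= 1 by rewrite ger0_norm ?flat_ge0 ?flat_le1.
have d1 := flat_lipschitz (B - x) (B - y).
have d2 := flat_lipschitz (B + x) (B + y).
have E1 : B - x - (B - y) = - (x - y) by ring.
have E2 : B + x - (B + y) = x - y by ring.
rewrite E1 normrN in d1; rewrite E2 in d2.
apply: le_trans (ler_normD _ _) _; rewrite !normrM.
have -> : 4 * `|x - y| = 2 * `|x - y| * 1 + 1 * (2 * `|x - y|) by ring.
by apply: lerD; apply: ler_pM.
Qed.

Let prod_bump_factor_itv (P : pred 'I_n.+1) (v : 'rV[R]_n.+1) :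
  0 <= \prod_(j | P j) bump_factor (v 0 j) <= 1.
Proof.
apply/andP; split; last by apply: prodr_ile1 => j _; exact: bump_factor_itv.
by apply: prodr_ge0 => j _; case/andP: (bump_factor_itv (v 0 j)).
Qed.

Lemma box_bump_itv v : 0 <= box_bump v <= 1.
Proof.
rewrite /box_bump; move: (prod_bump_factor_itv xpredT v); set P := \prod_j _; lra.
Qed.

Lemma box_bump_contract v s : `|box_bump (v + s *: e0) - box_bump v| <= 2^-1 * `|s|.
Proof.
rewrite /box_bump -mulrBr (bigD1 ord0)//= [X in _ - X](bigD1 ord0)//=.
have -> : \prod_(i < n.+1 | i != ord0) bump_factor ((v + s *: e0) 0 i) =
    \prod_(i < n.+1 | i != ord0) bump_factor (v 0 i).
  apply: eq_bigr => i /negbTE i0; congr bump_factor.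
  by rewrite !mxE i0 andbF mulr0 addr0.
set P := \prod_(i < n.+1 | _) _.
have P_itv : 0 <= P <= 1 by exact: prod_bump_factor_itv.
have := bump_factor_lipschitz ((v + s *: e0) 0 0) (v 0 0).
rewrite !mxE /= mulr1 addrAC subrr add0r => H.
rewrite -mulrBl !normrM (ger0_norm (_ : 0 <= 8^-1))// (ger0_norm (_ : 0 <= P)).
  have -> : 2^-1 * `|s| = 8^-1 * (4 * `|s| * 1) by field.
  rewrite ler_wpM2l// ler_pM//; by case/andP: P_itv.
by case/andP: P_itv.
Qed.

Lemma box_bump_support v : box_bump v != 0 -> forall j, `|v 0 j| <= B.
Proof.
move=> bv j; rewrite leNgt; apply: contra bv => vj.
rewrite /box_bump (bigD1 j)//= (_ : bump_factor (v 0 j) = 0) ?mul0r ?mulr0//.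
rewrite /bump_factor /flat; case: ifP => [h1|_]; last by rewrite mul0r.
case: ifP => [h2|_]; last by rewrite mulr0.
by move: vj; rewrite ltNge ler_norml; lra.
Qed.

(** For [|x| <= A] both [B - x] and [B + x] are at least [B - A]. The bound is the least progress of
    a push inside the smaller box. *)
Lemma box_bump_lower (A : R) : A < B ->
  exists2 c : R, 0 < c &
    forall v : 'rV[R]_n.+1, (forall j, `|v 0 j| <= A) -> c <= box_bump v.
Proof.
move=> AB; have f0 : 0 < flat 0 (B - A) by rewrite flat_gt0 ?subr_gt0.
exists (8^-1 * \prod_(j < n.+1) (flat 0 (B - A) * flat 0 (B - A))).
  by rewrite mulr_gt0// prodr_gt0// => j _; rewrite mulr_gt0.
move=> v vA; rewrite ler_wpM2l//; apply: ler_prod => j _.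
have /andP[v1 v2] : - A <= v 0 j <= A by rewrite -ler_norml.
rewrite mulr_ge0 ?flat_ge0//=; apply: ler_pM; rewrite ?flat_ge0//.
  by apply: flat_nondecreasing; lra.
by apply: flat_nondecreasing; lra.
Qed.

Let oT : open [set: 'rV[R]_n.+1]. Proof. exact: openT. Qed.

Lemma Ck_box_bump k : Ck k setT box_bump.
Proof.
apply: (Ck_mul oT (Ck_cst _ _ _)); apply: (Ck_prod oT) => j.
have cj : Ck k setT (fun v : 'rV[R]_n.+1 => v 0 j).
  exact: (Ck_coord j oT (Ck_id _ _)).
have cNj : Ck k setT (fun v : 'rV[R]_n.+1 => - v 0 j).
  refine (@Ck_ext R _ R k setT _ _ oT _
    (Ck_mul oT (@Ck_cst R _ R k setT (- 1)) cj)) => v _.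
  by rewrite mulN1r.
have cB := @Ck_cst R n.+1 R k setT B.
exact: (Ck_mul oT (Ck_flat 0 oT (Ck_add oT cB cNj))
  (Ck_flat 0 oT (Ck_add oT cB cj))).
Qed.

End Bump.

Section EuclideanMaps.
Variables (R : realType) (r : option nat).

Lemma Cr_map_euclidean m n (h : 'rV[R]_m -> 'rV[R]_n) :
  (forall k, Ck k setT h) ->
  @Cr_map R r m n (euclidean R r m) (euclidean R r n) h.
Proof.
move=> hC; split=> [x|c c' -> -> k _]; first exact: Ck_cont (hC 0) x I.
exact: Ck_sub (@subsetT _ _) (hC k).
Qed.

Lemma Cr_map_prod_euclidean m p n (h : 'rV[R]_m * 'rV[R]_p -> 'rV[R]_n) :
  (forall k, Ck k setT (fun v : 'rV[R]_(m + p) => h (lsubmx v, rsubmx v))) ->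
  @Cr_map R r _ _ (prod_manifold (euclidean R r m) (euclidean R r p))
    (euclidean R r n) h.
Proof.
move=> hC; split=> [x|c c' [[a b] [/= -> ->] <-] -> k _]; last first.
  exact: Ck_sub (@subsetT _ _) (hC k).
have -> : h = (fun v => h (lsubmx v, rsubmx v)) \o
    prod_chart (rV_chart R m) (rV_chart R p).
  by apply/funext => -[u w]; rewrite /= row_mxKl row_mxKr.
have c1 : {for x, continuous (prod_chart (rV_chart R m) (rV_chart R p))}.
  exact: chart_fun_cont.
have c2 : {for prod_chart (rV_chart R m) (rV_chart R p) x,
    continuous (fun v : 'rV[R]_(m + p) => h (lsubmx v, rsubmx v))}.
  exact: (Ck_cont (hC 0%N)).
exact: (continuous_comp c1 c2).
Qed.

End EuclideanMaps.

(** * Slides of the product, transported to [Z] *)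

Section Slide.
Variables (R : realType) (r : option nat) (d n m : nat).
Variables (M : manifold R r d) (Z : manifold R r m).
Variables (f : Z -> prod_manifold M (euclidean R r n.+1))
  (g : prod_manifold M (euclidean R r n.+1) -> Z).
Hypothesis M_compact : compact [set: M].
Hypotheses (fK : cancel f g) (gK : cancel g f).
Hypotheses (f_Cr : Cr_map f) (g_Cr : Cr_map g).
Variable B : R.

Let e0 : 'rV[R]_n.+1 := delta_mx 0 0.
(* [clip] makes [slide t] a bijection for all [t], also outside [[0, 1]]. *)
Let clip (t : R) : R := Num.max 0 (Num.min t 1).
Let rho (t : R) (v : 'rV[R]_n.+1) : R := clip t * box_bump B v.

Let clip_itv t : 0 <= clip t <= 1.
Proof. by rewrite /clip le_max lexx /= ge_max ler01 ge_min lexx orbT. Qed.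

Let clip_id t : t \in `[0, 1] -> clip t = t.
Proof.
by rewrite in_itv /= => /andP[t0 t1]; rewrite /clip (min_idPl t1) (max_idPr t0).
Qed.

Let oT : open [set: 'rV[R]_n.+1]. Proof. exact: openT. Qed.

Let rho_Ck t k : Ck k setT (rho t).
Proof.
exact: (Ck_mul oT (@Ck_cst R _ R k setT (clip t)) (@Ck_box_bump R n B k)).
Qed.

Let rho_itv t v : 0 <= rho t v <= 1.
Proof.
have /andP[c0 c1] := clip_itv t; have /andP[b0 b1] := box_bump_itv B v.
by rewrite mulr_ge0//= mulr_ile1.
Qed.

Let rho_contract t v s : `|rho t (v + s *: e0) - rho t v| <= 2^-1 * `|s|.
Proof.
have /andP[c0 c1] := clip_itv t.
rewrite -mulrBr normrM ger0_norm// -[leRHS]mul1r.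
by apply: ler_pM => //; exact: box_bump_contract.
Qed.

Let rho_diff t p : differentiable (rho t) p.
Proof. by case: (rho_Ck t 1) => + _; exact. Qed.

Definition slide_fun (h : 'rV[R]_n.+1 -> 'rV[R]_n.+1) (z : Z) : Z :=
  g ((f z).1, h (f z).2).

Lemma slide_funK h h' : cancel h h' -> cancel (slide_fun h) (slide_fun h').
Proof. by move=> hK z; rewrite /slide_fun gK /= hK -surjective_pairing fK. Qed.

Definition slide (t : R) : selfbij Z := SelfBij
  (slide_funK (pushK (rho_diff t) (rho_itv t) (rho_contract t)))
  (slide_funK (pullK e0 (rho_diff t) (rho_itv t))).

Lemma slide_fun_Cr h : (forall k, Ck k setT h) -> Cr_map (slide_fun h).
Proof.
move=> /(@Cr_map_euclidean R r) hC.
have p1 := Cr_map_comp f_Cr (@Cr_map_fst R r _ _ M (euclidean R r n.+1)).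
have p2 := Cr_map_comp f_Cr (@Cr_map_snd R r _ _ M (euclidean R r n.+1)).
exact: Cr_map_comp (Cr_map_pair p1 (Cr_map_comp p2 hC)) g_Cr.
Qed.

(** A compact set, independent of the time, that supports the whole isotopy. *)
Let slab : set Z :=
  g @` ([set: M] `*` [set v : 'rV[R]_n.+1 | forall j, `|v 0 j| <= B]).

Let slab_compact : compact slab.
Proof.
apply: continuous_compact.
  by apply: continuous_subspaceT; case: g_Cr.
apply: compact_setX => //.
rewrite (_ : [set v | _] =
  [set v : 'rV[R]_n.+1 | forall j, `[- B, B]%classic (v ord0 j)]).
  exact: (@rV_compact R n.+1 (fun=> `[- B, B]%classic)
    (fun=> @segment_compact R (- B) B)).
by apply/seteqP; split=> v /= vB j; have := vB j; rewrite /= in_itv /= ler_norml.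
Qed.

Lemma slide_support t : Defs.support (slide t) `<=` slab.
Proof.
have slab_closed : closed slab.
  exact: compact_closed (@manifold_hausdorff _ _ _ Z) slab_compact.
rewrite ((closure_id slab).1 slab_closed); apply: closureS => z /= zt.
exists (f z); last exact: fK.
split=> // j; apply: (@box_bump_support R n B); apply: contra_notN zt => /eqP b0.
by rewrite /slide_fun /push /rho b0 mulr0 scale0r addr0 -surjective_pairing fK.
Qed.

Lemma slide_Diff_c t : Diff_c_set (slide t).
Proof.
split.
- by apply: slide_fun_Cr => k; apply: Ck_push => //; exact: rho_Ck.
- apply: slide_fun_Cr => k.
  exact: (Ck_pull (rho_Ck t) (rho_itv t) (rho_contract t)).
- apply: subclosed_compact slab_compact (@slide_support t).
  exact: closed_closure.
Qed.

(** The time enters unclipped, as [clip] is not differentiable; for times in [[0, 1]] this agrees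
    with the push defining [slide]. *)
Let slide_family (p : 'rV[R]_n.+1 * 'rV[R]_1) : 'rV[R]_n.+1 :=
  p.1 + (p.2 0 0 * box_bump B p.1) *: e0.

Let slide_family_Cr : @Cr_map R r _ _
  (prod_manifold (euclidean R r n.+1) (euclidean R r 1)) (euclidean R r n.+1)
  slide_family.
Proof.
apply: Cr_map_prod_euclidean => k; rewrite /slide_family /=.
have oS : open [set: 'rV[R]_(n.+1 + 1)] by exact: openT.
have lC : Ck k setT (fun v : 'rV[R]_(n.+1 + 1) => lsubmx v) by exact: Ck_lsubmx.
have rC : Ck k setT (fun v : 'rV[R]_(n.+1 + 1) => rsubmx v) by exact: Ck_rsubmx.
have bC : Ck k setT (fun v : 'rV[R]_(n.+1 + 1) => box_bump B (lsubmx v)).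
  exact: (@Ck_comp1 R _ _ k setT setT _ (box_bump B) oS (fun _ _ => I) lC
    (@Ck_box_bump R n B k)).
exact: (Ck_add oS lC (Ck_scalel e0 oS (Ck_mul oS (Ck_coord 0 oS rC) bC))).
Qed.

Lemma slide1_Diff_c0 : Diff_c0_set (slide 1).
Proof.
pose F (p : Z * 'rV[R]_1) : Z := g ((f p.1).1, slide_family ((f p.1).2, p.2)).
have F_Cr : @Cr_map R r _ _ (prod_manifold Z (euclidean R r 1)) Z F.
  have z_Cr := Cr_map_comp (@Cr_map_fst R r _ _ Z (euclidean R r 1)) f_Cr.
  have p1 := Cr_map_comp z_Cr (@Cr_map_fst R r _ _ M (euclidean R r n.+1)).
  have p2 := Cr_map_comp z_Cr (@Cr_map_snd R r _ _ M (euclidean R r n.+1)).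
  have p3 := Cr_map_pair p2 (@Cr_map_snd R r _ _ Z (euclidean R r 1)).
  exact: Cr_map_comp (Cr_map_pair p1 (Cr_map_comp p3 slide_family_Cr)) g_Cr.
exists slide, F, slab; split => //.
- move=> t t01; split; [exact: slide_Diff_c | exact: slide_support|] => z.
  by rewrite /= /slide_fun /push /rho clip_id// /F /slide_family /= mxE.
- apply: selfbij_eq => z; rewrite /= /slide_fun /push /rho clip_id.
    by rewrite mul0r scale0r addr0 -surjective_pairing fK.
  by rewrite in_itv /= lexx ler01.
Qed.

Lemma slide1E z : f (slide 1 z) = ((f z).1, (f z).2 + box_bump B (f z).2 *: e0).
Proof.
rewrite /= /slide_fun gK /push /rho clip_id ?mul1r//.
by rewrite in_itv /= lexx ler01.
Qed.

End Slide.

(** * Displacing compact sets *)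

Section Displacement.
Variables (R : realType) (r : option nat) (d n m : nat).
Variables (M : manifold R r d) (Z : manifold R r m).
Hypothesis M_compact : compact [set: M].
Hypothesis Z_diffeo : diffeomorphic Z (prod_manifold M (euclidean R r n.+1)).

(** A power of one slide suffices. While a point is in the box of size [A], each step raises its
    first coordinate by at least [c] and fixes the others; once beyond [A] it stays there, as the
    bump is nonnegative. *)
Lemma compact_displaceable (K : set Z) : compact K ->
  exists2 t, Diff_c0_set t & forall x, K x -> ~ K (t x).
Proof.
move=> cK; have [f [g [fK gK f_Cr g_Cr]]] := Z_diffeo.
pose q (z : Z) : 'rV[R]_n.+1 := (f z).2.
have q_cont : continuous q.
  by case: (Cr_map_comp f_Cr (@Cr_map_snd R r _ _ M (euclidean R r n.+1))).
have [A A0 qA] : exists2 A : R, 0 < A & forall z, K z -> forall j, `|q z 0 j| <= A.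
  have qK : compact (q @` K).
    by apply: continuous_compact => //; exact: continuous_subspaceT.
  have [A [_ bA]] := compact_bounded qK.
  exists (`|A| + 1) => [|z Kz j]; first by rewrite ltr_wpDl.
  have := bA (`|A| + 1) _ (q z) (imageP _ Kz).
  rewrite (le_lt_trans (ler_norm A)) ?ltrDl// => /(_ isT).
  apply: le_trans; rewrite [`|q z|]mx_normrE.
  exact: (le_bigmax _ (fun ij => `|q z ij.1 ij.2|) (0, j)).
(* The bump lives on a slightly larger box, so that it is bounded below on the box containing the
   image of [K]. *)
have [c c0 cP] : exists2 c : R, 0 < c & forall v : 'rV[R]_n.+1,
    (forall j, `|v 0 j| <= A) -> c <= box_bump (A + 1) v.
  by apply: box_bump_lower; rewrite ltrDl.
pose s := slide fK gK (A + 1) 1.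
have sE y j : q (s y) 0 j = q y 0 j + box_bump (A + 1) (q y) * (j == 0)%:R.
  by rewrite /q slide1E /= !mxE.
have step i : exists2 t, Diff_c0_set t & forall z, K z -> A < q (t z) 0 0 \/
    (forall j, `|q (t z) 0 j| <= A) /\ - A + i%:R * c <= q (t z) 0 0.
  elim: i => [|i [t tD tP]].
    exists 1%g => [|z Kz]; first exact: Diff_c0_set1.
    right; split=> [j|]; first exact: qA.
    by rewrite mul0r addr0; have := qA z Kz 0; rewrite ler_norml => /andP[].
  exists (s * t)%g => [|z Kz].
    by apply: Diff_c0_setM => //; exact: slide1_Diff_c0.
  have /andP[b0 _] := box_bump_itv (A + 1) (q (t z)).
  have sE0 : q (s (t z)) 0 0 = q (t z) 0 0 + box_bump (A + 1) (q (t z)).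
    by rewrite sE eqxx mulr1.
  rewrite /= sE0; have [tA|[tA ti]] := tP z Kz; first by left; lra.
  have bc := cP _ tA.
  have [Aq|qA'] := ltP A (q (t z) 0 0 + box_bump (A + 1) (q (t z))); first by left.
  right; split=> [j|]; last by rewrite -natr1 mulrDl mul1r; lra.
  have [->|j0] := eqVneq j 0; last by rewrite sE (negbTE j0) mulr0 addr0.
  by rewrite sE0 ler_norml qA' andbT; have := tA 0; rewrite ler_norml; lra.
(* More than [2 * A / c] steps carry the first coordinate from [- A] beyond [A]. *)
have [t tD tP] := step (Num.truncn (2 * A / c)).+1.
exists t => // z Kz Ktz; have := qA _ Ktz 0; rewrite ler_norml => /andP[_ tzA].
have [|[_]] := tP z Kz; first by rewrite ltNge tzA.
have := truncnS_gt (2 * A / c); rewrite ltr_pdivrMr//; lra.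
Qed.

End Displacement.

Theorem theorem1p6 (R : realType) (r : option nat) (d n m : nat)
    (M : manifold R r d) (Z : manifold R r m) :
  compact [set: M] -> (1 <= n)%N ->
  diffeomorphic Z (prod_manifold M (euclidean R r n)) ->
  [/\ boundedly_acyclic R (Homeo_c Z),
      boundedly_acyclic R (Homeo_c0 R Z),
      boundedly_acyclic R (Diff_c Z)
    & boundedly_acyclic R (Diff_c0 Z)].
Proof.
move=> cM; case: n => // n _ Zd.
(* The displacing element lies in [Diff_c0], hence in all four groups. *)
have disp := compact_displaceable cM Zd.
split; apply: displaceable_boundedly_acyclic => [f Hf|K /disp[t Ht tK]].
- by case: Hf.
- by exists t => //; exact/Diff_c_Homeo_c/Diff_c0_Diff_c.
- have [H [L [_ _ HL _ <-]]] := Hf.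
  by have /HL[[]] : (1 : R) \in `[0, 1] by rewrite in_itv /= ler01 lexx.
- by exists t => //; exact: Diff_c0_Homeo_c0.
- by case: Hf.
- by exists t => //; exact: Diff_c0_Diff_c.
- by case: (Diff_c0_Diff_c Hf).
- by exists t.
Qed.
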